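(* Let $\lambda\in\mathbb{R}\setminus\{0\}$ and let $(\alpha_j)_{j\in\mathbb{Z}}\in \ell^1(\mathbb{Z})$ be complex numbers. For $\varepsilon>0$ with $1/\varepsilon\in\mathbb{N}^*$, let $u^\varepsilon$ be the solution of $$ i\varepsilon\,\partial_t u^\varepsilon+\frac{\varepsilon^2}{2}\partial_x^2 u^\varepsilon=\lambda\,\varepsilon\,|u^\varepsilon|^2u^\varepsilon,\qquad x\in\mathbb{T},\qquad u^\varepsilon(0,x)=u_0^\varepsilon(x), $$ where the initial data $u_0^\varepsilon\in W(\mathbb{T})$ satisfy, for some $C_0\ge 0$ independent of $\varepsilon$, $$\Big\| u_0^\varepsilon-\sum_{j\in\mathbb{Z}}\alpha_j e^{ijx/\varepsilon}\Big\|_{W(\mathbb{T})}\le C_0\,\varepsilon .$$ Then for all $T>0$ there exist $C=C(T)$ and $\varepsilon_0>0$ such that for all $\varepsilon\in\,]0,\varepsilon_0]$ with $1/\varepsilon\in\mathbb{N}^*$, $$\sup_{t\in[0,T]}\big\|u^\varepsilon(t)-u^\varepsilon_{\rm app}(t)\big\|_{L^\infty(\mathbb{T})}\le C\varepsilon,$$ where $$u^\varepsilon_{\rm app}(t,x)=\sum_{j\in\mathbb{Z}}\alpha_j\,e^{-i\lambda t(2M-|\alpha_j|^2)}\,e^{i(jx-\frac12 j^2t)/\varepsilon},\qquad M=\sum_{k\in\mathbb{Z}}|\alpha_k|^2 .$$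
   Context: $\mathbb{T}=\mathbb{R}/2\pi\mathbb{Z}$ and $\mathbb{N}^*=\{1,2,3,\dots\}$. $W(\mathbb{T})$ is the Wiener algebra of functions $f(x)=\sum_{k\in\mathbb{Z}}b_ke^{ikx}$ with $(b_k)\in\ell^1(\mathbb{Z})$, normed by $\|f\|_W=\sum_k|b_k|$. Solutions are understood in $C([0,T];W(\mathbb{T}))$ (in the Duhamel sense). *)

(* Defs.v *)
From Stdlib Require Import Reals ZArith Lra Lia FunctionalExtensionality ProofIrrelevance.
From Coquelicot Require Import Coquelicot.
Open Scope R_scope.

(** * Series indexed by Z *)

Definition ex_sumZ (a : Z -> R) : Prop :=
  ex_series (fun n : nat => a (Z.of_nat n)) /\
  ex_series (fun n : nat => a (- Z.of_nat (S n))%Z).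

Definition sumZ (a : Z -> R) : R :=
  Series (fun n : nat => a (Z.of_nat n)) +
  Series (fun n : nat => a (- Z.of_nat (S n))%Z).

(** Only meaningful when both component series converge; every use below is on an
    absolutely summable family. *)
Definition CsumZ (a : Z -> C) : C :=
  (sumZ (fun k => Re (a k)), sumZ (fun k => Im (a k))).

Definition ell1 (a : Z -> C) : Prop := ex_sumZ (fun k => Cmod (a k)).

Definition expi (theta : R) : C := (cos theta, sin theta).

Lemma Cmod_expi theta : Cmod (expi theta) = 1.
Proof.
  unfold Cmod, expi; simpl fst; simpl snd.
  rewrite <- sqrt_1; f_equal.
  generalize (sin2_cos2 theta); unfold Rsqr; intros H; nra.
Qed.

Lemma ex_sumZ_le (a b : Z -> R) :
  (forall k, 0 <= a k <= b k) -> ex_sumZ b -> ex_sumZ a.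
Proof.
  intros H [H1 H2]; split;
    [ refine (@ex_series_le R_AbsRing R_CompleteNormedModule _ _ _ H1)
    | refine (@ex_series_le R_AbsRing R_CompleteNormedModule _ _ _ H2) ];
    intros n; unfold norm; simpl; unfold abs; simpl;
    rewrite Rabs_pos_eq; apply H.
Qed.

Lemma ex_sumZ_plus (a b : Z -> R) :
  ex_sumZ a -> ex_sumZ b -> ex_sumZ (fun k => a k + b k).
Proof.
  intros [H1 H2] [H3 H4]; split.
  - exact (ex_series_plus _ _ H1 H3).
  - exact (ex_series_plus _ _ H2 H4).
Qed.

Lemma ex_sumZ_scal (c : R) (a : Z -> R) : ex_sumZ a -> ex_sumZ (fun k => c * a k).
Proof.
  intros [H1 H2]; split.
  - exact (ex_series_scal c _ H1).
  - exact (ex_series_scal c _ H2).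
Qed.

Lemma sumZ_le (a b : Z -> R) :
  (forall k, 0 <= a k <= b k) -> ex_sumZ b -> sumZ a <= sumZ b.
Proof.
  intros H [H1 H2]; unfold sumZ; apply Rplus_le_compat;
    (apply Series_le; [ intros n; apply H | assumption ]).
Qed.

Lemma sumZ_plus (a b : Z -> R) :
  ex_sumZ a -> ex_sumZ b -> sumZ (fun k => a k + b k) = sumZ a + sumZ b.
Proof.
  intros [H1 H2] [H3 H4]; unfold sumZ.
  rewrite (Series_plus _ _ H1 H3), (Series_plus _ _ H2 H4); ring.
Qed.

Lemma sumZ_scal (c : R) (a : Z -> R) : sumZ (fun k => c * a k) = c * sumZ a.
Proof. unfold sumZ; rewrite 2!Series_scal_l; ring. Qed.

Lemma Series_ge_term (a : nat -> R) :
  (forall n, 0 <= a n) -> ex_series a -> forall n, a n <= Series a.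
Proof.
  intros Ha H n; revert a Ha H; induction n as [|n IH]; intros a Ha H;
    rewrite (Series_incr_1 a H).
  - assert (0 <= Series (fun k => a (S k))); [|lra].
    rewrite <- (Rmult_0_l (Series (fun _ => 0))), <- Series_scal_l.
    apply Series_le.
    + intros k; split; [lra | rewrite Rmult_0_l; apply Ha].
    + exact (proj1 (ex_series_incr_1 a) H).
  - generalize (Ha 0%nat)
      (IH (fun k => a (S k)) (fun k => Ha (S k)) (proj1 (ex_series_incr_1 a) H)).
    lra.
Qed.

Lemma sumZ_ge_term (a : Z -> R) :
  (forall k, 0 <= a k) -> ex_sumZ a -> forall k, a k <= sumZ a.
Proof.
  intros Ha [H1 H2] k; unfold sumZ.
  assert (T1 := Series_ge_term _ (fun n => Ha _) H1).
  assert (T2 := Series_ge_term _ (fun n => Ha _) H2).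
  assert (P1 := Rle_trans _ _ _ (Ha _) (T1 0%nat)).
  assert (P2 := Rle_trans _ _ _ (Ha _) (T2 0%nat)).
  destruct (Z_le_gt_dec 0 k) as [Hk|Hk].
  - generalize (T1 (Z.to_nat k)); cbv beta; rewrite Z2Nat.id by lia; lra.
  - generalize (T2 (Z.to_nat (- k - 1))); cbv beta.
    replace (- Z.of_nat (S (Z.to_nat (- k - 1))))%Z with k by lia; lra.
Qed.

(** * The Wiener algebra W(T)

    An element is carried by its coefficient sequence; the function on
    T = R/2piZ it denotes is the 2pi-periodic [weval], and the two determine
    each other by uniqueness of Fourier coefficients. *)

Record Wiener : Type := mkWiener
  { wcoef : Z -> C;
    wcoef_ell1 : ell1 wcoef }.

Definition weval (w : Wiener) (x : R) : C :=
  CsumZ (fun k => Cmult (wcoef w k) (expi (IZR k * x))).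

Definition wnorm (w : Wiener) : R := sumZ (fun k => Cmod (wcoef w k)).

Lemma Wiener_eq (v w : Wiener) : (forall k, wcoef v k = wcoef w k) -> v = w.
Proof.
  destruct v as [a Ha], w as [b Hb]; simpl; intros H.
  apply functional_extensionality in H; subst b.
  f_equal; apply proof_irrelevance.
Qed.

Lemma ell1_zero : ell1 (fun _ => RtoC 0).
Proof.
  split; exists 0; apply is_series_Reals; intros e He; exists 0%nat; intros n _;
    rewrite (sum_eq_R0 _ n) by (intros; apply Cmod_0);
    unfold Rdist; rewrite Rminus_0_r, Rabs_R0; exact He.
Qed.

Lemma ell1_plus a b : ell1 a -> ell1 b -> ell1 (fun k => Cplus (a k) (b k)).
Proof.
  intros Ha Hb.
  apply (ex_sumZ_le _ (fun k => Cmod (a k) + Cmod (b k))).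
  - intros k; split; [apply Cmod_ge_0 | apply Cmod_triangle].
  - apply ex_sumZ_plus; assumption.
Qed.

Definition bounded_symbol (m : Z -> C) : Prop :=
  exists B : R, forall k, Cmod (m k) <= B.

Lemma ell1_multiplier m a :
  bounded_symbol m -> ell1 a -> ell1 (fun k => Cmult (m k) (a k)).
Proof.
  intros [B HB] Ha.
  apply (ex_sumZ_le _ (fun k => B * Cmod (a k))).
  - intros k; rewrite Cmod_mult; split.
    + apply Rmult_le_pos; apply Cmod_ge_0.
    + apply Rmult_le_compat_r; [apply Cmod_ge_0 | apply HB].
  - apply ex_sumZ_scal; exact Ha.
Qed.

Lemma bounded_symbol_const c : bounded_symbol (fun _ => c).
Proof. exists (Cmod c); intros _; apply Rle_refl. Qed.

Lemma bounded_symbol_expi f : bounded_symbol (fun k => expi (f k)).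
Proof. exists 1; intros k; rewrite Cmod_expi; apply Rle_refl. Qed.

Definition wzero : Wiener := mkWiener _ ell1_zero.

Definition wplus (v w : Wiener) : Wiener :=
  mkWiener _ (ell1_plus _ _ (wcoef_ell1 v) (wcoef_ell1 w)).

Definition wmultiplier (m : Z -> C) (hm : bounded_symbol m) (w : Wiener) : Wiener :=
  mkWiener _ (ell1_multiplier m _ hm (wcoef_ell1 w)).

Definition wCscal (c : C) (w : Wiener) : Wiener :=
  wmultiplier (fun _ => c) (bounded_symbol_const c) w.

Definition wopp (w : Wiener) : Wiener := wCscal (RtoC (-1)) w.

Definition wscal (r : R) (w : Wiener) : Wiener := wCscal (RtoC r) w.

Ltac wiener_eq := apply Wiener_eq; intros k; simpl; apply injective_projections; simpl; ring.

Lemma wplus_comm v w : wplus v w = wplus w v.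
Proof. wiener_eq. Qed.
Lemma wplus_assoc u v w : wplus u (wplus v w) = wplus (wplus u v) w.
Proof. wiener_eq. Qed.
Lemma wplus_zero_r w : wplus w wzero = w.
Proof. wiener_eq. Qed.
Lemma wplus_opp_r w : wplus w (wopp w) = wzero.
Proof. wiener_eq. Qed.

Definition Wiener_AbelianMonoid_mixin :=
  AbelianMonoid.Mixin Wiener wplus wzero wplus_comm wplus_assoc wplus_zero_r.
Canonical Wiener_AbelianMonoid :=
  AbelianMonoid.Pack Wiener Wiener_AbelianMonoid_mixin Wiener.

Definition Wiener_AbelianGroup_mixin :=
  AbelianGroup.Mixin Wiener_AbelianMonoid wopp wplus_opp_r.
Canonical Wiener_AbelianGroup :=
  AbelianGroup.Pack Wiener
    (AbelianGroup.Class _ Wiener_AbelianMonoid_mixin Wiener_AbelianGroup_mixin) Wiener.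

Lemma wscal_assoc (x y : R) w : wscal x (wscal y w) = wscal (x * y) w.
Proof. wiener_eq. Qed.
Lemma wscal_one w : wscal 1 w = w.
Proof. wiener_eq. Qed.
Lemma wscal_plus_l (x : R) v w : wscal x (wplus v w) = wplus (wscal x v) (wscal x w).
Proof. wiener_eq. Qed.
Lemma wscal_plus_r (x y : R) w : wscal (x + y) w = wplus (wscal x w) (wscal y w).
Proof. wiener_eq. Qed.

Definition Wiener_ModuleSpace_mixin :=
  ModuleSpace.Mixin R_Ring Wiener_AbelianGroup wscal
    wscal_assoc wscal_one wscal_plus_l wscal_plus_r.
Canonical Wiener_ModuleSpace :=
  ModuleSpace.Pack R_Ring Wiener
    (ModuleSpace.Class R_Ring _ (AbelianGroup.class Wiener_AbelianGroup)
       Wiener_ModuleSpace_mixin) Wiener.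

Lemma wnorm_triangle v w : wnorm (wplus v w) <= wnorm v + wnorm w.
Proof.
  unfold wnorm.
  rewrite <- (sumZ_plus _ _ (wcoef_ell1 v) (wcoef_ell1 w)).
  apply sumZ_le.
  - intros k; split; [apply Cmod_ge_0 | apply Cmod_triangle].
  - apply ex_sumZ_plus; apply wcoef_ell1.
Qed.

Lemma wnorm_Cscal c w : wnorm (wCscal c w) = Cmod c * wnorm w.
Proof.
  unfold wnorm; rewrite <- sumZ_scal.
  unfold sumZ; f_equal; apply Series_ext; intros n; apply Cmod_mult.
Qed.

Lemma wnorm_scal r w : wnorm (wscal r w) = Rabs r * wnorm w.
Proof. unfold wscal; rewrite wnorm_Cscal, Cmod_R; reflexivity. Qed.

Lemma wnorm_eq_0 w : wnorm w = 0 -> w = wzero.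
Proof.
  intros H; apply Wiener_eq; intros k; simpl.
  apply Cmod_eq_0, Rle_antisym; [|apply Cmod_ge_0].
  rewrite <- H.
  apply (sumZ_ge_term (fun k => Cmod (wcoef w k)));
    [intros; apply Cmod_ge_0 | apply wcoef_ell1].
Qed.

Definition wball (v : Wiener) (e : R) (w : Wiener) : Prop := wnorm (minus w v) < e.

Lemma wball_center v (e : posreal) : wball v e v.
Proof.
  unfold wball; replace (minus v v) with (wscal 0 v) by wiener_eq.
  rewrite wnorm_scal, Rabs_R0, Rmult_0_l; apply cond_pos.
Qed.

Lemma wball_sym v w e : wball v e w -> wball w e v.
Proof.
  unfold wball; intros H.
  replace (minus v w) with (wscal (- (1)) (minus w v)) by wiener_eq.
  rewrite wnorm_scal, Rabs_Ropp, Rabs_R1, Rmult_1_l; exact H.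
Qed.

Lemma wball_triangle u v w e1 e2 : wball u e1 v -> wball v e2 w -> wball u (e1 + e2) w.
Proof.
  unfold wball; intros H1 H2.
  replace (minus w u) with (wplus (minus w v) (minus v u)) by wiener_eq.
  generalize (wnorm_triangle (minus w v) (minus v u)); lra.
Qed.

Definition Wiener_UniformSpace_mixin :=
  UniformSpace.Mixin Wiener wzero wball wball_center wball_sym wball_triangle.
Canonical Wiener_UniformSpace :=
  UniformSpace.Pack Wiener Wiener_UniformSpace_mixin Wiener.

Canonical Wiener_NormedModuleAux :=
  NormedModuleAux.Pack R_AbsRing Wiener
    (NormedModuleAux.Class R_AbsRing _ (ModuleSpace.class R_Ring Wiener_ModuleSpace)
       Wiener_UniformSpace_mixin) Wiener.

Lemma wnorm_scal_le (r : R) (w : Wiener) : wnorm (scal r w) <= abs r * wnorm w.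
Proof. right; apply wnorm_scal. Qed.
Lemma wnorm_ball (v w : Wiener) (e : R) : wnorm (minus w v) < e -> ball v e w.
Proof. intros H; exact H. Qed.
Lemma wball_norm (v w : Wiener) (e : posreal) : ball v e w -> wnorm (minus w v) < 1 * e.
Proof. intros H; rewrite Rmult_1_l; exact H. Qed.

Definition Wiener_NormedModule_mixin :=
  NormedModule.Mixin R_AbsRing Wiener_NormedModuleAux wnorm 1
    wnorm_triangle wnorm_scal_le wnorm_ball wball_norm wnorm_eq_0.
Canonical Wiener_NormedModule :=
  NormedModule.Pack R_AbsRing Wiener
    (NormedModule.Class R_AbsRing _ (NormedModuleAux.class R_AbsRing Wiener_NormedModuleAux)
       Wiener_NormedModule_mixin) Wiener.

(** * The semiclassical cubic NLS on T *)

(** exp(i eps (t/2) d_x^2) *)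
Definition free_flow (eps t : R) : Wiener -> Wiener :=
  wmultiplier (fun k => expi (- (eps * IZR k ^ 2 * t / 2))) (bounded_symbol_expi _).

(** [u] is a C([0,T];W) solution, in the Duhamel sense, of
    i eps d_t u + (eps^2/2) d_x^2 u = lambda eps |u|^2 u,  u(0) = w0, that is
    u(t) = U(t) w0 - i lambda int_0^t U(t-s) (|u|^2 u)(s) ds  with  U = [free_flow eps]
    and a W-valued integral. [F s] is the element of W denoting the function
    |u(s)|^2 u(s); it always exists, W being an algebra stable by conjugation. *)
Definition NLS_solution (lambda eps T : R) (w0 : Wiener) (u : R -> Wiener) : Prop :=
  continuous_on (fun t => 0 <= t <= T) u /\
  exists F : R -> Wiener,
    (forall s, 0 <= s <= T -> forall x : R,
       weval (F s) x = Cmult (RtoC (Cmod (weval (u s) x) ^ 2)) (weval (u s) x)) /\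
    (forall t, 0 <= t <= T ->
       exists I : Wiener,
         is_RInt (fun s => free_flow eps (t - s) (F s)) 0 t I /\
         u t = minus (free_flow eps t w0) (wCscal (Cmult Ci (RtoC lambda)) I)).

(** On T the functions concerned are continuous, so the essential supremum is the
    supremum. *)
Definition Linf_norm (f : R -> C) : Rbar :=
  Lub_Rbar (fun r => exists x : R, r = Cmod (f x)).

Definition u_app (lambda : R) (alpha : Z -> C) (eps t x : R) : C :=
  let M := sumZ (fun k => Cmod (alpha k) ^ 2) in
  CsumZ (fun j =>
    Cmult (Cmult (alpha j) (expi (- (lambda * t * (2 * M - Cmod (alpha j) ^ 2)))))
          (expi ((IZR j * x - / 2 * IZR j ^ 2 * t) / eps))).

Definition recip_posint (eps : R) : Prop :=
  exists N : nat, (1 <= N)%nat /\ 1 / eps = INR N.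

(* Main.v *)
Require Import Defs.
From Stdlib Require Import Reals ZArith List Lra Lia.
From Coquelicot Require Import Coquelicot.
Open Scope R_scope.

(** Let N = 1/eps. The approximate solution only excites the frequencies j N, and its
    amplitudes alpha_j exp(-i theta_j t), with theta_j = lambda (2 M - |alpha_j|^2), solve
    the system obtained from the equation by keeping, in the cubic sum over
    a - b + c = j, only the resonant triples a^2 - b^2 + c^2 = j^2. Since
    j^2 - a^2 + b^2 - c^2 = 2 (b - a) (b - c), these are the triples with a = b or b = c.
    On all other triples the Duhamel integrand oscillates in time with a frequency of
    modulus at least 1/(2 eps) for small eps, so that its integral is O(eps)
    ([Eint_osc], [Eint_nonres]).

    As alpha is merely summable, the profile is first cut to finitely many modes
    ([profile]), the discarded l^1 mass being at most eps. Everything about it is then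
    a finite sum, and [profile_defect] shows that it satisfies the Duhamel formula up to
    an error O(eps) in W; the only effect of the cut there is the replacement of M by a
    partial sum. The Duhamel formula is Lipschitz in W on bounded sets
    ([cubic_lipschitz]), so a Gronwall estimate bounds u - profile by O(eps) as long as
    this difference is at most 1, and a continuity argument removes that proviso
    ([duhamel_stability]). The W-norm dominates the supremum norm, which gives the
    theorem.

    The algebra property of W is used through functions and not through convolutions:
    [inball f B] says that f is a uniform limit of trigonometric polynomials of W-norm at
    most B. This predicate is trivially stable under sums, products and conjugation, and
    by [inball_wnorm] it bounds the W-norm of any element of W denoting f: Fourier
    coefficients are mean values, hence pass to uniform limits. In particular it contains
    the uniqueness of Fourier coefficients, which identifies the nonlinearity in the
    Duhamel formula. *)

(** The complex numbers as a real normed space. *)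
Local Notation CR := (prod_NormedModule R_AbsRing R_NormedModule R_NormedModule).

(** * Finite sums over lists of integers, and the series over Z *)

(** The sum of [f] over a list of integers, in any commutative monoid. *)
Fixpoint lsum {G : AbelianMonoid} (l : list Z) (f : Z -> G) : G :=
  match l with
  | nil => zero
  | cons k l' => plus (f k) (lsum l' f)
  end.

Section LsumGeneric.
Context {G : AbelianMonoid}.

Lemma lsum_ext (l : list Z) (f g : Z -> G) :
  (forall k, In k l -> f k = g k) -> lsum l f = lsum l g.
Proof.
  induction l as [|k l IH]; intros H; [reflexivity|]; simpl.
  rewrite (H k (or_introl eq_refl)), IH; [reflexivity|].
  intros j Hj; apply H; right; exact Hj.
Qed.

Lemma lsum_zero (l : list Z) : lsum l (fun _ => zero) = (zero : G).
Proof.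
  induction l as [|k l IH]; simpl; [reflexivity|]; rewrite IH; apply plus_zero_l.
Qed.

Lemma lsum_plus (l : list Z) (f g : Z -> G) :
  lsum l (fun k => plus (f k) (g k)) = plus (lsum l f) (lsum l g).
Proof.
  induction l as [|k l IH]; simpl; [symmetry; apply plus_zero_l|].
  rewrite IH, <- !plus_assoc; f_equal.
  rewrite !plus_assoc; f_equal; apply plus_comm.
Qed.

Lemma lsum_app (l1 l2 : list Z) (f : Z -> G) :
  lsum (l1 ++ l2) f = plus (lsum l1 f) (lsum l2 f).
Proof.
  induction l1 as [|k l IH]; simpl; [symmetry; apply plus_zero_l|].
  rewrite IH; apply plus_assoc.
Qed.

Lemma lsum_swap (l1 l2 : list Z) (f : Z -> Z -> G) :
  lsum l1 (fun a => lsum l2 (fun b => f a b))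
  = lsum l2 (fun b => lsum l1 (fun a => f a b)).
Proof.
  induction l1 as [|k l IH]; simpl; [symmetry; apply lsum_zero|].
  rewrite IH, <- lsum_plus; reflexivity.
Qed.

Lemma lsum_delta (l : list Z) (a : Z) (f : Z -> G) :
  NoDup l -> In a l ->
  lsum l (fun k => if Z.eq_dec a k then f k else zero) = f a.
Proof.
  intros Hl; induction Hl as [|k l Hk Hl IH]; intros Ha; [destruct Ha|]; simpl.
  destruct (Z.eq_dec a k) as [<-|n].
  - rewrite (lsum_ext _ _ (fun _ => zero)), lsum_zero; [apply plus_zero_r|].
    intros j Hj; destruct (Z.eq_dec a j) as [<-|]; [contradiction|reflexivity].
  - destruct Ha as [Ha|Ha]; [congruence|].
    rewrite (IH Ha); apply plus_zero_l.
Qed.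

End LsumGeneric.

Lemma lsum_morph {G H : AbelianMonoid} (h : G -> H) :
  h zero = zero -> (forall x y, h (plus x y) = plus (h x) (h y)) ->
  forall l f, h (lsum l f) = lsum l (fun k => h (f k)).
Proof.
  intros h0 hp l f; induction l as [|k l IH]; simpl; [exact h0|].
  rewrite hp, IH; reflexivity.
Qed.

Lemma lsum_le (l : list Z) (f g : Z -> R) :
  (forall k, In k l -> f k <= g k) -> lsum l f <= lsum l g.
Proof.
  induction l as [|k l IH]; intros H; simpl; [apply Rle_refl|].
  apply Rplus_le_compat; [apply H; left; reflexivity|].
  apply IH; intros j Hj; apply H; right; exact Hj.
Qed.

Lemma lsum_nonneg (l : list Z) (f : Z -> R) : (forall k, 0 <= f k) -> 0 <= lsum l f.
Proof.
  intros H; induction l as [|k l IH]; [apply Rle_refl|].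
  apply Rplus_le_le_0_compat; [apply H|exact IH].
Qed.

Lemma lsum_scal_l (l : list Z) (c : R) (f : Z -> R) :
  lsum l (fun k => c * f k) = c * lsum l f.
Proof.
  symmetry; apply (lsum_morph (G := R_AbelianMonoid) (H := R_AbelianMonoid) (Rmult c)).
  - apply Rmult_0_r.
  - intros; apply Rmult_plus_distr_l.
Qed.

Lemma lsum_const (l : list Z) (c : R) : lsum l (fun _ => c) = INR (length l) * c.
Proof.
  induction l as [|k l IH]; [simpl; symmetry; apply Rmult_0_l|].
  change (c + lsum l (fun _ => c) = INR (S (length l)) * c).
  rewrite IH, S_INR; ring.
Qed.

Lemma Cmult_lsum_l (c : C) (l : list Z) (f : Z -> C) :
  Cmult c (lsum l f) = lsum l (fun k => Cmult c (f k)).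
Proof.
  apply (lsum_morph (G := C_AbelianMonoid) (H := C_AbelianMonoid) (Cmult c)).
  - apply Cmult_0_r.
  - intros; apply Cmult_plus_distr_l.
Qed.

Lemma Cmult_lsum_r (c : C) (l : list Z) (f : Z -> C) :
  Cmult (lsum l f) c = lsum l (fun k => Cmult (f k) c).
Proof.
  rewrite Cmult_comm, Cmult_lsum_l; apply lsum_ext; intros; apply Cmult_comm.
Qed.

Lemma Cconj_lsum (l : list Z) (f : Z -> C) :
  Cconj (lsum l f) = lsum l (fun k => Cconj (f k)).
Proof.
  apply (lsum_morph (G := C_AbelianMonoid) (H := C_AbelianMonoid) Cconj).
  - apply injective_projections; simpl; ring.
  - intros; apply Cplus_conj.
Qed.

Lemma Cmod_lsum (l : list Z) (f : Z -> C) :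
  Cmod (lsum l f) <= lsum l (fun k => Cmod (f k)).
Proof.
  induction l as [|k l IH]; simpl; [right; apply Cmod_0|].
  eapply Rle_trans; [apply Cmod_triangle|].
  apply Rplus_le_compat_l, IH.
Qed.

(** The integers k with -n <= k < n. The asymmetry matches the splitting of a series over
    Z into the indices k >= 0 and k < 0. *)
Fixpoint zlist (n : nat) : list Z :=
  match n with
  | O => nil
  | S m => Z.of_nat m :: (- Z.of_nat (S m))%Z :: zlist m
  end.

Lemma zlist_In n k : In k (zlist n) <-> (- Z.of_nat n <= k < Z.of_nat n)%Z.
Proof.
  induction n as [|n IH]; [simpl; lia|].
  change (In k (zlist (S n))) with
    (Z.of_nat n = k \/ (- Z.of_nat (S n))%Z = k \/ In k (zlist n)).
  rewrite IH; lia.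
Qed.

Lemma zlist_NoDup n : NoDup (zlist n).
Proof.
  induction n as [|n IH]; [constructor|].
  change (NoDup (Z.of_nat n :: (- Z.of_nat (S n))%Z :: zlist n)).
  constructor; [|constructor; [|exact IH]].
  - intros [H|H]; [lia|]. apply zlist_In in H; lia.
  - intros H; apply zlist_In in H; lia.
Qed.

(** The integers of [zlist (n + p)] that are not in [zlist n]. *)
Fixpoint ztail (n p : nat) : list Z :=
  match p with
  | O => nil
  | S q => Z.of_nat (n + q) :: (- Z.of_nat (S (n + q)))%Z :: ztail n q
  end.

Lemma zlist_add n p : zlist (n + p) = ztail n p ++ zlist n.
Proof.
  induction p as [|p IH]; [rewrite Nat.add_0_r; reflexivity|].
  rewrite Nat.add_succ_r; simpl; rewrite IH; reflexivity.
Qed.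

Lemma lsum_zlist (a : Z -> R) n :
  lsum (zlist (S n)) a
  = sum_n (fun i => a (Z.of_nat i)) n + sum_n (fun i => a (- Z.of_nat (S i))%Z) n.
Proof.
  induction n as [|n IH].
  - rewrite !sum_O; simpl; unfold plus, zero; simpl; ring.
  - rewrite !sum_Sn.
    change (a (Z.of_nat (S n)) + (a (- Z.of_nat (S (S n)))%Z + lsum (zlist (S n)) a)
      = (sum_n (fun i => a (Z.of_nat i)) n + a (Z.of_nat (S n)))
        + (sum_n (fun i => a (- Z.of_nat (S i))%Z) n + a (- Z.of_nat (S (S n)))%Z)).
    rewrite IH; ring.
Qed.

Lemma is_lim_sumZ (a : Z -> R) :
  ex_sumZ a -> is_lim_seq (fun n => lsum (zlist n) a) (sumZ a).
Proof.
  intros [H1 H2]; apply is_lim_seq_incr_1.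
  apply (is_lim_seq_ext (fun n => sum_n (fun i => a (Z.of_nat i)) n
            + sum_n (fun i => a (- Z.of_nat (S i))%Z) n)).
  - intros n; symmetry; apply lsum_zlist.
  - apply (is_lim_seq_plus' _ _ _ _ (Series_correct _ H1) (Series_correct _ H2)).
Qed.

Lemma lsum_le_sumZ (a : Z -> R) n :
  (forall k, 0 <= a k) -> ex_sumZ a -> lsum (zlist n) a <= sumZ a.
Proof.
  intros Ha H.
  apply (is_lim_seq_le (fun _ => lsum (zlist n) a) (fun p => lsum (zlist (n + p)) a)
           (lsum (zlist n) a) (sumZ a)).
  - intros p; rewrite zlist_add, lsum_app.
    generalize (lsum_nonneg (ztail n p) a Ha).
    change (0 <= lsum (ztail n p) a ->
      lsum (zlist n) a <= lsum (ztail n p) a + lsum (zlist n) a); lra.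
  - apply is_lim_seq_const.
  - apply (is_lim_seq_ext (fun p => lsum (zlist (p + n)) a)).
    + intros p; rewrite Nat.add_comm; reflexivity.
    + apply (is_lim_seq_incr_n (fun p => lsum (zlist p) a) n), is_lim_sumZ, H.
Qed.

Lemma sumZ_le_bound (a : Z -> R) B :
  ex_sumZ a -> (forall n, lsum (zlist n) a <= B) -> sumZ a <= B.
Proof.
  intros H HB.
  apply (is_lim_seq_le (fun p => lsum (zlist p) a) (fun _ => B) (sumZ a) B HB).
  - apply is_lim_sumZ, H.
  - apply is_lim_seq_const.
Qed.

Lemma lsum_ztail (a : Z -> R) n p :
  lsum (ztail n p) a = lsum (zlist (n + p)) a - lsum (zlist n) a :> R.
Proof.
  rewrite zlist_add, lsum_app.
  change (@plus R_AbelianMonoid) with Rplus.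
  symmetry; ring.
Qed.

(** What remains of a series over Z after its terms of index -n <= k < n. *)
Definition tailZ (a : Z -> R) (n : nat) : R := sumZ a - lsum (zlist n) a.

Lemma tailZ_ge_0 (a : Z -> R) n : (forall k, 0 <= a k) -> ex_sumZ a -> 0 <= tailZ a n.
Proof. intros Ha H; generalize (lsum_le_sumZ a n Ha H); unfold tailZ; lra. Qed.

Lemma lsum_ztail_le (a : Z -> R) n p :
  (forall k, 0 <= a k) -> ex_sumZ a -> lsum (ztail n p) a <= tailZ a n.
Proof.
  intros Ha H; rewrite lsum_ztail; unfold tailZ.
  generalize (lsum_le_sumZ a (n + p) Ha H); lra.
Qed.

Lemma tailZ_small (a : Z -> R) (d : R) :
  (forall k, 0 <= a k) -> ex_sumZ a -> 0 < d ->
  exists n, forall m, (n <= m)%nat -> tailZ a m <= d.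
Proof.
  intros Ha H Hd.
  destruct (proj2 (is_lim_seq_spec _ _) (is_lim_sumZ a H) (mkposreal d Hd)) as [n Hn].
  exists n; intros m Hm; specialize (Hn m Hm); simpl in Hn.
  apply Rabs_def2 in Hn; unfold tailZ; lra.
Qed.

(** Comparison of remainders needs no sign on [a] and [b]: it is [lsum_le_sumZ] for
    [c b - a]. *)
Lemma tailZ_le (a b : Z -> R) (c : R) n :
  (forall k, a k <= c * b k) -> ex_sumZ a -> ex_sumZ b -> tailZ a n <= c * tailZ b n.
Proof.
  intros Hab Ha Hb.
  assert (E : ex_sumZ (fun k => c * b k + -1 * a k))
    by (apply ex_sumZ_plus; apply ex_sumZ_scal; assumption).
  assert (H := lsum_le_sumZ (fun k => c * b k + -1 * a k) n
    ltac:(intros k; specialize (Hab k); lra) E).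
  rewrite sumZ_plus in H by (apply ex_sumZ_scal; assumption).
  rewrite !sumZ_scal in H.
  assert (E2 := lsum_plus (G := R_AbelianMonoid) (zlist n) (fun k => c * b k)
    (fun k => -1 * a k)).
  rewrite !lsum_scal_l in E2.
  apply (Rle_trans _ _ _ (Req_le _ _ (eq_sym E2))) in H.
  change (c * lsum (zlist n) b + -1 * lsum (zlist n) a
    <= c * sumZ b + -1 * sumZ a) in H.
  unfold tailZ; lra.
Qed.

Lemma ell1_Re c : ell1 c -> ex_sumZ (fun k => Re (c k)) /\ ex_sumZ (fun k => Im (c k)).
Proof.
  assert (K : forall f : C -> R, (forall z, Rabs (f z) <= Cmod z) ->
    ell1 c -> ex_sumZ (fun k => f (c k))).
  { intros f Hf [H1 H2]; split;
      [ refine (@ex_series_le R_AbsRing R_CompleteNormedModule _ _ _ H1)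
      | refine (@ex_series_le R_AbsRing R_CompleteNormedModule _ _ _ H2) ];
      intros n; apply Hf. }
  intros H; split; apply K; try exact H; intros z;
    generalize (Rmax_Cmod z); [apply Rle_trans, Rmax_l | apply Rle_trans, Rmax_r].
Qed.

Lemma CsumZ_plus a b : ell1 a -> ell1 b ->
  CsumZ (fun k => Cplus (a k) (b k)) = Cplus (CsumZ a) (CsumZ b).
Proof.
  intros Ha Hb; apply ell1_Re in Ha; apply ell1_Re in Hb.
  unfold CsumZ, Cplus; simpl; f_equal; [apply (sumZ_plus (fun k => Re (a k)) (fun k => Re (b k)))
    | apply (sumZ_plus (fun k => Im (a k)) (fun k => Im (b k)))]; tauto.
Qed.

Lemma CsumZ_scal c a : ell1 a -> CsumZ (fun k => Cmult c (a k)) = Cmult c (CsumZ a).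
Proof.
  intros Ha; apply ell1_Re in Ha; destruct Ha as [H1 H2].
  unfold CsumZ, Cmult; simpl; f_equal.
  - rewrite <- (sumZ_scal (fst c)).
    replace (sumZ (fun k => fst c * Re (a k)) - snd c * sumZ (fun k => Im (a k)))
      with (sumZ (fun k => fst c * Re (a k)) + (- snd c) * sumZ (fun k => Im (a k))) by ring.
    rewrite <- (sumZ_scal (- snd c)), <- sumZ_plus by (apply ex_sumZ_scal; assumption).
    unfold sumZ; f_equal; apply Series_ext; intros n; unfold Re, Im; ring.
  - rewrite <- !sumZ_scal, <- sumZ_plus by (apply ex_sumZ_scal; assumption).
    unfold sumZ; f_equal; apply Series_ext; intros n; unfold Re, Im; ring.
Qed.

Lemma CsumZ_ext a b : (forall k, a k = b k) -> CsumZ a = CsumZ b.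
Proof.
  intros H; unfold CsumZ, sumZ; f_equal; f_equal;
    apply Series_ext; intros; rewrite H; reflexivity.
Qed.

Lemma Re_lsum l (c : Z -> C) : Re (lsum l c) = lsum l (fun k => Re (c k)).
Proof.
  apply (lsum_morph (G := C_AbelianMonoid) (H := R_AbelianMonoid) Re); reflexivity.
Qed.
Lemma Im_lsum l (c : Z -> C) : Im (lsum l c) = lsum l (fun k => Im (c k)).
Proof.
  apply (lsum_morph (G := C_AbelianMonoid) (H := R_AbelianMonoid) Im); reflexivity.
Qed.

Lemma Cmod_CsumZ_tail c n :
  ell1 c -> Cmod (Cminus (CsumZ c) (lsum (zlist n) c)) <= tailZ (fun k => Cmod (c k)) n.
Proof.
  intros Hc.
  destruct (ell1_Re c Hc) as [HR HI].
  apply Rnot_lt_le; intros Hlt.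
  set (d := (Cmod (Cminus (CsumZ c) (lsum (zlist n) c)) - tailZ (fun k => Cmod (c k)) n) / 4).
  assert (Hd : 0 < d) by (unfold d; lra).
  destruct (proj2 (is_lim_seq_spec _ _) (is_lim_sumZ _ HR) (mkposreal d Hd)) as [p1 Hp1].
  destruct (proj2 (is_lim_seq_spec _ _) (is_lim_sumZ _ HI) (mkposreal d Hd)) as [p2 Hp2].
  set (p := (p1 + p2)%nat).
  specialize (Hp1 (n + p)%nat ltac:(unfold p; lia)).
  specialize (Hp2 (n + p)%nat ltac:(unfold p; lia)).
  simpl in Hp1, Hp2.
  assert (H1 : Cmod (Cminus (CsumZ c) (lsum (zlist (n + p)) c)) <= 2 * d).
  { eapply Rle_trans; [apply Cmod_2Rmax|].
    assert (S2 : sqrt 2 <= 2).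
    { rewrite <- (sqrt_Rsqr 2) at 2 by lra; apply sqrt_le_1_alt; unfold Rsqr; lra. }
    apply Rmult_le_compat; [apply sqrt_pos| |exact S2|].
    { eapply Rle_trans; [|apply Rmax_l]; apply Rabs_pos. }
    rewrite Rabs_minus_sym in Hp1; rewrite Rabs_minus_sym in Hp2.
    rewrite <- Re_lsum in Hp1; rewrite <- Im_lsum in Hp2.
    apply Rmax_lub; left; [exact Hp1|exact Hp2]. }
  assert (H2 : Cmod (lsum (ztail n p) c) <= tailZ (fun k => Cmod (c k)) n).
  { eapply Rle_trans; [apply Cmod_lsum|].
    apply (lsum_ztail_le (fun k => Cmod (c k))); [intros; apply Cmod_ge_0|exact Hc]. }
  assert (H3 : Cminus (CsumZ c) (lsum (zlist n) c)
    = Cplus (Cminus (CsumZ c) (lsum (zlist (n + p)) c)) (lsum (ztail n p) c)).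
  { rewrite zlist_add, lsum_app.
    change (@plus C_AbelianMonoid) with Cplus; ring. }
  generalize (Cmod_triangle (Cminus (CsumZ c) (lsum (zlist (n + p)) c)) (lsum (ztail n p) c)).
  rewrite <- H3; unfold d in *; lra.
Qed.

(** * Integrals of oscillating exponentials *)

Lemma expi_plus a b : expi (a + b) = Cmult (expi a) (expi b).
Proof. unfold expi, Cmult; simpl; rewrite cos_plus, sin_plus; f_equal; ring. Qed.

Lemma expi_opp a : expi (- a) = Cconj (expi a).
Proof. unfold expi, Cconj; simpl; rewrite cos_neg, sin_neg; reflexivity. Qed.

Lemma expi_0 : expi 0 = RtoC 1.
Proof. unfold expi; rewrite cos_0, sin_0; reflexivity. Qed.

Lemma norm_C_R (z : C) :
  norm (z : CR) = Cmod z.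
Proof.
  unfold norm; simpl; unfold prod_norm, norm; simpl; unfold abs; simpl.
  unfold Cmod; rewrite <- (pow2_abs (fst z)), <- (pow2_abs (snd z)); reflexivity.
Qed.

(** Integrals commute with bounded linear maps. *)
Lemma is_RInt_linear {U V : NormedModule R_AbsRing} (h : U -> V) (f : R -> U) a b I :
  is_linear h -> is_RInt f a b I -> is_RInt (fun s => h (f s)) a b (h I).
Proof.
  intros Hh HI; unfold is_RInt.
  assert (h0 : h zero = zero).
  { transitivity (h (scal zero zero)); [f_equal; symmetry; apply (scal_zero_l (V := U))|].
    rewrite (linear_scal h Hh); apply (scal_zero_l (V := V)). }
  apply (filterlim_ext (fun ptd => h (scal (sign (b - a)) (Riemann_sum f ptd)))).
  - intros ptd; rewrite (linear_scal h Hh); f_equal.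
    apply (SF_cons_ind (T := R) (fun p => h (Riemann_sum f p) = Riemann_sum (fun s => h (f s)) p)).
    + intros x; exact h0.
    + intros h1 s IH; rewrite !Riemann_sum_cons, (linear_plus h Hh), IH; f_equal.
      apply (linear_scal h Hh).
  - eapply filterlim_comp; [exact HI|]. apply (linear_cont h I Hh).
Qed.

(** The integral of exp(i w s) for s from 0 to t. The case w = 0 is separate because of the
    division. *)
Definition Eint (w t : R) : C :=
  if Req_EM_T w 0 then RtoC t else (sin (w * t) / w, (1 - cos (w * t)) / w).

Lemma is_RInt_expi w t : is_RInt (fun s => expi (w * s)) 0 t (Eint w t).
Proof.
  unfold Eint; destruct (Req_EM_T w 0) as [->|Hw].
  - apply (is_RInt_ext (fun _ => RtoC 1)).
    + intros s _; rewrite Rmult_0_l, expi_0; reflexivity.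
    + replace (RtoC t) with
        (scal (t - 0) (RtoC 1 : CR)).
      * apply (is_RInt_const (V := CR)).
      * unfold scal; simpl; unfold prod_scal, scal; simpl; unfold mult; simpl.
        unfold RtoC; f_equal; ring.
  - apply (is_RInt_fct_extend_pair (U := R_NormedModule) (V := R_NormedModule)); simpl.
    + replace (sin (w * t) / w) with (minus (sin (w * t) / w) (sin (w * 0) / w)).
      * apply (is_RInt_derive (fun s => sin (w * s) / w)).
        -- intros s _; auto_derive; [trivial|field; exact Hw].
        -- intros s _; apply (continuous_comp (fun s => w * s) cos);
             [apply (continuous_mult (fun _ => w) (fun s => s));
              [apply continuous_const|apply continuous_id] | apply continuous_cos].
      * unfold minus, plus, opp; simpl; rewrite Rmult_0_r, sin_0; field; exact Hw.
    + replace ((1 - cos (w * t)) / w) with (minus (- cos (w * t) / w) (- cos (w * 0) / w)).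
      * apply (is_RInt_derive (fun s => - cos (w * s) / w)).
        -- intros s _; auto_derive; [trivial|field; exact Hw].
        -- intros s _; apply (continuous_comp (fun s => w * s) sin);
             [apply (continuous_mult (fun _ => w) (fun s => s));
              [apply continuous_const|apply continuous_id] | apply continuous_sin].
      * unfold minus, plus, opp; simpl; rewrite Rmult_0_r, cos_0; field; exact Hw.
Qed.

Lemma Eint_eq w t : Cmult (Cmult Ci (RtoC w)) (Eint w t) = Cminus (expi (w * t)) (RtoC 1).
Proof.
  unfold Eint; destruct (Req_EM_T w 0) as [->|Hw].
  - rewrite Rmult_0_l, expi_0; apply injective_projections; simpl; ring.
  - apply injective_projections; simpl; field; exact Hw.
Qed.

(** An oscillating integral is small when the phase is fast. *)
Lemma Eint_osc w t : Rabs w * Cmod (Eint w t) <= 2.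
Proof.
  replace (Rabs w * Cmod (Eint w t)) with (Cmod (Cmult (Cmult Ci (RtoC w)) (Eint w t))).
  - rewrite Eint_eq.
    eapply Rle_trans; [apply Cmod_triangle|].
    rewrite Cmod_opp, Cmod_expi, Cmod_1; lra.
  - rewrite !Cmod_mult, Cmod_Ci, Cmod_R; ring.
Qed.

Lemma is_RInt_cst (c t : R) : is_RInt (fun _ => c) 0 t (c * t).
Proof.
  replace (c * t) with (scal (t - 0) c).
  - apply (is_RInt_const (V := R_NormedModule)).
  - unfold scal; simpl; unfold mult; simpl; ring.
Qed.

Lemma Eint_le w t : 0 <= t -> Cmod (Eint w t) <= t.
Proof.
  intros Ht; rewrite <- norm_C_R, <- (Rmult_1_l t).
  apply (norm_RInt_le (V := CR)
           (fun s => expi (w * s)) (fun _ => 1) 0 t).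
  - exact Ht.
  - intros s _; rewrite norm_C_R, Cmod_expi; apply Rle_refl.
  - rewrite Rmult_1_l; apply is_RInt_expi.
  - apply is_RInt_cst.
Qed.

(** * Evaluation is linear on W *)

(** Unimodular factors do not affect summability. *)
Lemma ell1_twist a (f : Z -> R) : ell1 a -> ell1 (fun k => Cmult (a k) (expi (f k))).
Proof.
  intros Ha; apply (ex_sumZ_le _ (fun k => Cmod (a k))); [|exact Ha].
  intros k; rewrite Cmod_mult, Cmod_expi, Rmult_1_r; split; [apply Cmod_ge_0|apply Rle_refl].
Qed.

Lemma weval_wplus v w x : weval (wplus v w) x = Cplus (weval v x) (weval w x).
Proof.
  unfold weval; rewrite <- CsumZ_plus by (apply ell1_twist, wcoef_ell1).
  apply CsumZ_ext; intros k; simpl; ring.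
Qed.

Lemma weval_wCscal c w x : weval (wCscal c w) x = Cmult c (weval w x).
Proof.
  unfold weval; rewrite <- CsumZ_scal by (apply ell1_twist, wcoef_ell1).
  apply CsumZ_ext; intros k; simpl; ring.
Qed.

Lemma weval_minus v w x : weval (minus v w) x = Cminus (weval v x) (weval w x).
Proof.
  change (minus v w) with (wplus v (wCscal (RtoC (-1)) w)).
  rewrite weval_wplus, weval_wCscal; apply injective_projections; simpl; ring.
Qed.

Lemma weval_wzero x : weval wzero x = RtoC 0.
Proof.
  assert (E := weval_minus wzero wzero x).
  replace (minus wzero wzero) with wzero in E by wiener_eq.
  rewrite E; ring.
Qed.

Lemma weval_lsum l (f : Z -> Wiener) x :
  weval (lsum l f) x = lsum l (fun k => weval (f k) x).
Proof.
  apply (lsum_morph (G := Wiener_AbelianMonoid) (H := C_AbelianMonoid) (fun w => weval w x)).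
  - apply weval_wzero.
  - intros; apply weval_wplus.
Qed.

Lemma wnorm_ge_0 w : 0 <= wnorm w.
Proof. apply (norm_ge_0 (V := Wiener_NormedModule)). Qed.

Lemma wnorm_lsum l (f : Z -> Wiener) : wnorm (lsum l f) <= lsum l (fun k => wnorm (f k)).
Proof.
  induction l as [|k l IH]; simpl.
  - right; apply (norm_zero (V := Wiener_NormedModule)).
  - eapply Rle_trans; [apply wnorm_triangle|]. apply Rplus_le_compat_l, IH.
Qed.

(** ** Monomials *)

(** The coefficient sequence with a single 1, at index k. *)
Definition delta (k j : Z) : C := if Z.eq_dec k j then RtoC 1 else RtoC 0.

Lemma lsum_delta_mul k n (f : Z -> C) :
  In k (zlist n) -> lsum (zlist n) (fun j => Cmult (delta k j) (f j)) = f k.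
Proof.
  intros Hk; rewrite <- (lsum_delta (G := C_AbelianMonoid) (zlist n) k f (zlist_NoDup n) Hk).
  apply lsum_ext; intros j _; unfold delta; destruct (Z.eq_dec k j);
    [apply Cmult_1_l | apply Cmult_0_l].
Qed.

Lemma ell1_delta k : ell1 (delta k).
Proof.
  assert (Z0 : ex_series (fun _ : nat => 0)).
  { exists 0; change (is_lim_seq (sum_n (fun _ => 0)) 0).
    apply (is_lim_seq_ext (fun _ => 0)); [|apply is_lim_seq_const].
    intros p; rewrite sum_n_const; ring. }
  assert (K : forall g : nat -> Z, (forall n m, g n = g m -> n = m) ->
    ex_series (fun n => Cmod (delta k (g n)))).
  { intros g Hg.
    assert (D : (exists n, g n = k) \/ forall n, g n <> k).
    { destruct (Classical_Prop.classic (exists n, g n = k)) as [H|H]; [left; exact H|right].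
      intros n Hn; apply H; exists n; exact Hn. }
    destruct D as [[n Hn]|D].
    - apply (ex_series_incr_n _ (S n)).
      apply (ex_series_ext (fun _ => 0)).
      + intros p; unfold delta; destruct (Z.eq_dec k (g (S n + p)%nat)) as [e|];
          [|symmetry; apply Cmod_0].
        rewrite <- Hn in e; apply Hg in e; lia.
      + exact Z0.
    - apply (ex_series_ext (fun _ => 0)).
      + intros p; unfold delta; destruct (Z.eq_dec k (g p)) as [e|];
          [|symmetry; apply Cmod_0]. symmetry in e; destruct (D _ e).
      + exact Z0. }
  split; [apply (K Z.of_nat) | apply (K (fun n => (- Z.of_nat (S n))%Z))]; intros; lia.
Qed.

(** The function exp(i k x). *)
Definition wmono (k : Z) : Wiener := mkWiener (delta k) (ell1_delta k).

Lemma weval_wmono k x : weval (wmono k) x = expi (IZR k * x).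
Proof.
  apply Ceq_minus; apply Cmod_eq_0, Rle_antisym; [|apply Cmod_ge_0].
  apply Rnot_lt_le; intros Hlt.
  assert (E := ell1_twist _ (fun j => IZR j * x) (ell1_delta k)).
  destruct (tailZ_small (fun j => Cmod (Cmult (delta k j) (expi (IZR j * x)))) _
    ltac:(intros; apply Cmod_ge_0) E (Rdiv_lt_0_compat _ 2 Hlt Rlt_0_2)) as [n Hn].
  set (m := (n + Z.to_nat (Z.abs k + 1))%nat).
  specialize (Hn m ltac:(unfold m; lia)).
  assert (T := Cmod_CsumZ_tail _ m E); simpl in T.
  rewrite (lsum_delta_mul k m (fun j => expi (IZR j * x))) in T
    by (apply zlist_In; unfold m; lia).
  change (CsumZ (fun k0 : Z => (delta k k0 * expi (IZR k0 * x))%C)) with (weval (wmono k) x) in T.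
  lra.
Qed.

Lemma wnorm_wmono k : wnorm (wmono k) <= 1.
Proof.
  apply sumZ_le_bound; [apply ell1_delta|]; intros n; simpl.
  assert (H : forall l, NoDup l -> lsum l (fun j => Cmod (delta k j)) <= 1 /\
    (~ In k l -> lsum l (fun j => Cmod (delta k j)) = 0)).
  { intros l Hl; induction Hl as [|j l Hj Hl [IH1 IH2]]; simpl.
    - split; [change (0 <= 1); lra|reflexivity].
    - change (Cmod (delta k j) + lsum l (fun j => Cmod (delta k j)) <= 1 /\
       (~ (j = k \/ In k l) -> Cmod (delta k j) + lsum l (fun j => Cmod (delta k j)) = 0)).
      unfold delta at 1 3; destruct (Z.eq_dec k j) as [<-|ne].
      + rewrite Cmod_1, IH2 by exact Hj; split; [lra|tauto].
      + rewrite Cmod_0; split; [lra|]. intros H; rewrite IH2 by tauto; lra. }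
  apply H, zlist_NoDup.
Qed.

(** * Functions in a closed ball of W *)

(** A trigonometric polynomial, as a list of coefficients and frequencies. Frequencies may
    repeat, so [tweight] only bounds the W-norm from above, while [tcoef] collects the
    Fourier coefficient of index k. *)
Definition trig : Type := list (C * Z).

Fixpoint teval (l : trig) (x : R) : C :=
  match l with
  | nil => RtoC 0
  | (c, k) :: l' => Cplus (Cmult c (expi (IZR k * x))) (teval l' x)
  end.

Fixpoint tweight (l : trig) : R :=
  match l with
  | nil => 0
  | (c, _) :: l' => Cmod c + tweight l'
  end.

Fixpoint tcoef (l : trig) (k : Z) : C :=
  match l with
  | nil => RtoC 0
  | (c, j) :: l' => Cplus (if Z.eq_dec j k then c else RtoC 0) (tcoef l' k)
  end.

Lemma tweight_ge_0 l : 0 <= tweight l.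
Proof.
  induction l as [|[c k] l IH]; simpl; [lra|generalize (Cmod_ge_0 c); lra].
Qed.

Lemma Cmod_teval l x : Cmod (teval l x) <= tweight l.
Proof.
  induction l as [|[c k] l IH]; simpl; [rewrite Cmod_0; lra|].
  eapply Rle_trans; [apply Cmod_triangle|].
  rewrite Cmod_mult, Cmod_expi; lra.
Qed.

(** The polynomial of terms c_j exp(i ph(j) x), for j in a list. *)
Definition tlsum (l : list Z) (c : Z -> C) (ph : Z -> Z) : trig :=
  map (fun j => (c j, ph j)) l.

Lemma teval_tlsum l c ph x :
  teval (tlsum l c ph) x = lsum l (fun j => Cmult (c j) (expi (IZR (ph j) * x))).
Proof. induction l as [|k l IH]; simpl; [reflexivity|rewrite IH; reflexivity]. Qed.

Lemma tweight_tlsum l c ph : tweight (tlsum l c ph) = lsum l (fun j => Cmod (c j)).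
Proof. induction l as [|k l IH]; simpl; [reflexivity|rewrite IH; reflexivity]. Qed.

Lemma tcoef_tlsum_id l c k : NoDup l -> In k l -> tcoef (tlsum l c (fun j => j)) k = c k.
Proof.
  intros Hl Hk; rewrite <- (lsum_delta (G := C_AbelianMonoid) l k c Hl Hk).
  clear; induction l as [|j l IH]; simpl; [reflexivity|rewrite IH].
  change (@plus C_AbelianMonoid) with Cplus; f_equal.
  destruct (Z.eq_dec j k), (Z.eq_dec k j); (reflexivity || congruence).
Qed.

Lemma teval_app l1 l2 x : teval (l1 ++ l2) x = Cplus (teval l1 x) (teval l2 x).
Proof.
  induction l1 as [|[c k] l IH]; simpl; [ring|rewrite IH; ring].
Qed.
Lemma tweight_app l1 l2 : tweight (l1 ++ l2) = tweight l1 + tweight l2.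
Proof. induction l1 as [|[c k] l IH]; simpl; [ring|rewrite IH; ring]. Qed.
Lemma tcoef_app l1 l2 k : tcoef (l1 ++ l2) k = Cplus (tcoef l1 k) (tcoef l2 k).
Proof.
  induction l1 as [|[c j] l IH]; simpl; [ring|rewrite IH; ring].
Qed.

Definition tconj (l : trig) : trig := map (fun p => (Cconj (fst p), (- snd p)%Z)) l.

Lemma teval_tconj l x : teval (tconj l) x = Cconj (teval l x).
Proof.
  induction l as [|[c k] l IH]; simpl; [apply injective_projections; simpl; ring|].
  rewrite IH, Cplus_conj, Cmult_conj, <- expi_opp, opp_IZR; do 3 f_equal; ring.
Qed.
Lemma tweight_tconj l : tweight (tconj l) = tweight l.
Proof. induction l as [|[c k] l IH]; simpl; [reflexivity|rewrite IH, Cmod_conj; reflexivity]. Qed.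

(** Multiplication by c exp(i k x). *)
Definition tscal (c : C) (k : Z) (l : trig) : trig :=
  map (fun p => (Cmult c (fst p), (k + snd p)%Z)) l.

Lemma teval_tscal c k l x :
  teval (tscal c k l) x = Cmult (Cmult c (expi (IZR k * x))) (teval l x).
Proof.
  induction l as [|[d j] l IH]; simpl; [ring|].
  rewrite IH, plus_IZR, Rmult_plus_distr_r, expi_plus; ring.
Qed.
Lemma tweight_tscal c k l : tweight (tscal c k l) = Cmod c * tweight l.
Proof.
  induction l as [|[d j] l IH]; simpl; [ring|]; rewrite IH, Cmod_mult; ring.
Qed.
Lemma tcoef_tscal c k l j : tcoef (tscal c k l) j = Cmult c (tcoef l (j - k)).
Proof.
  induction l as [|[d i] l IH]; simpl; [ring|]; rewrite IH.
  destruct (Z.eq_dec (k + i) j), (Z.eq_dec i (j - k)); try lia; ring.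
Qed.

Fixpoint tmult (l1 l2 : trig) : trig :=
  match l1 with
  | nil => nil
  | (c, k) :: l1' => tscal c k l2 ++ tmult l1' l2
  end.

Lemma teval_tmult l1 l2 x : teval (tmult l1 l2) x = Cmult (teval l1 x) (teval l2 x).
Proof.
  induction l1 as [|[c k] l IH]; simpl; [ring|].
  rewrite teval_app, teval_tscal, IH; ring.
Qed.
Lemma tweight_tmult l1 l2 : tweight (tmult l1 l2) = tweight l1 * tweight l2.
Proof.
  induction l1 as [|[c k] l IH]; simpl; [ring|].
  rewrite tweight_app, tweight_tscal, IH; ring.
Qed.

(** The integral over [0,t] grows like t times the constant coefficient: all other terms
    have a frequency of modulus at least 1. *)
Lemma is_RInt_teval l t :
  exists I, is_RInt (teval l) 0 t I /\
    Cmod (Cminus I (Cmult (RtoC t) (tcoef l 0))) <= 2 * tweight l.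
Proof.
  induction l as [|[c k] l [I [HI HB]]]; simpl.
  - exists (RtoC 0); split.
    + assert (H := is_RInt_const (V := CR)
        0 t (RtoC 0)).
      refine (eq_rect _ (fun z => is_RInt (fun _ => RtoC 0) 0 t z) H _ _).
      unfold scal; simpl; unfold prod_scal, scal; simpl; unfold mult; simpl.
      unfold RtoC; f_equal; ring.
    + replace (Cminus (RtoC 0) (Cmult (RtoC t) (RtoC 0))) with (RtoC 0) by ring.
      rewrite Cmod_0; lra.
  - exists (Cplus (Cmult c (Eint (IZR k) t)) I); split.
    + apply (is_RInt_plus (V := CR)
        (fun x => Cmult c (expi (IZR k * x))) (teval l)); [|exact HI].
      apply (is_RInt_linear (U := CR)
        (V := CR)
        (fun z : C => Cmult c z)); [|apply is_RInt_expi].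
      constructor.
      * intros x y; apply Cmult_plus_distr_l.
      * intros r z; apply injective_projections; simpl; unfold scal; simpl; unfold mult; simpl; ring.
      * exists (Cmod c + 1); split; [generalize (Cmod_ge_0 c); lra|].
        intros z; rewrite !norm_C_R, Cmod_mult.
        apply Rmult_le_compat_r; [apply Cmod_ge_0|lra].
    + set (d := Cminus I (Cmult (RtoC t) (tcoef l 0))) in *.
      destruct (Z.eq_dec k 0) as [->|Hk].
      * replace (Cminus (Cplus (Cmult c (Eint (IZR 0) t)) I)
          (Cmult (RtoC t) (Cplus c (tcoef l 0)))) with d.
        -- generalize (Cmod_ge_0 c); lra.
        -- unfold d, Eint; destruct (Req_EM_T (IZR 0) 0) as [_|n]; [ring|destruct n; reflexivity].
      * replace (Cminus (Cplus (Cmult c (Eint (IZR k) t)) I)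
          (Cmult (RtoC t) (Cplus (RtoC 0) (tcoef l 0)))) with (Cplus (Cmult c (Eint (IZR k) t)) d)
          by (unfold d; ring).
        eapply Rle_trans; [apply Cmod_triangle|]. rewrite Cmod_mult.
        assert (H1 : 1 <= Rabs (IZR k)) by (rewrite <- abs_IZR; apply IZR_le; lia).
        assert (H2 := Eint_osc (IZR k) t).
        assert (H3 : Cmod (Eint (IZR k) t) <= 2).
        { generalize (Cmod_ge_0 (Eint (IZR k) t)); nra. }
        generalize (Cmod_ge_0 c); nra.
Qed.

(** A Fourier coefficient is a mean value, hence bounded by the supremum. *)
Lemma tcoef_le l k d : (forall x, Cmod (teval l x) <= d) -> Cmod (tcoef l k) <= d.
Proof.
  intros H.
  replace (tcoef l k) with (tcoef (tscal (RtoC 1) (- k) l) 0).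
  2: { rewrite tcoef_tscal, Cmult_1_l; f_equal; lia. }
  set (l' := tscal (RtoC 1) (- k) l).
  assert (H' : forall x, Cmod (teval l' x) <= d).
  { intros x; unfold l'; rewrite teval_tscal, !Cmod_mult, Cmod_expi, Cmod_1.
    rewrite !Rmult_1_l; apply H. }
  apply Rnot_lt_le; intros Hlt.
  set (z := tcoef l' 0) in *.
  (* The interval is long enough to contradict |t z| <= d t + 2 tweight l'. *)
  set (t := (2 * tweight l' + 1) / (Cmod z - d)).
  assert (Ht : 0 < t).
  { apply Rdiv_lt_0_compat; [generalize (tweight_ge_0 l'); lra|lra]. }
  destruct (is_RInt_teval l' t) as [I [HI HB]]; fold z in HB.
  assert (H1 : Cmod I <= d * t).
  { rewrite <- norm_C_R.
    apply (norm_RInt_le (V := CR)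
      (teval l') (fun _ => d) 0 t); [lra| |exact HI|apply is_RInt_cst].
    intros x _; rewrite norm_C_R; apply H'. }
  assert (H2 : Cmod (Cmult (RtoC t) z) <= Cmod I + 2 * tweight l').
  { replace (Cmult (RtoC t) z) with (Cminus I (Cminus I (Cmult (RtoC t) z))) by ring.
    eapply Rle_trans; [apply Cmod_triangle|]. rewrite Cmod_opp; lra. }
  rewrite Cmod_mult, Cmod_R, Rabs_pos_eq in H2 by lra.
  assert (H3 : t * (Cmod z - d) = 2 * tweight l' + 1) by (unfold t; field; lra).
  lra.
Qed.

(** [inball f B]: [f] is a uniform limit of trigonometric polynomials of W-norm at
    most [B], that is, [f] lies in the closure of a ball of W for uniform convergence. *)
Definition inball (f : R -> C) (B : R) : Prop :=
  forall d, 0 < d -> exists l : trig,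
    tweight l <= B /\ forall x, Cmod (Cminus (f x) (teval l x)) <= d.

Lemma inball_ext f g B : (forall x, f x = g x) -> inball f B -> inball g B.
Proof.
  intros E H d Hd; destruct (H d Hd) as [l [H1 H2]]; exists l; split; [exact H1|].
  intros x; rewrite <- E; apply H2.
Qed.

Lemma inball_le f B B' : B <= B' -> inball f B -> inball f B'.
Proof.
  intros E H d Hd; destruct (H d Hd) as [l [H1 H2]]; exists l; split; [lra|exact H2].
Qed.

Lemma inball_ge_0 f B : inball f B -> 0 <= B.
Proof.
  intros H; destruct (H 1 Rlt_0_1) as [l [H1 _]]; generalize (tweight_ge_0 l); lra.
Qed.

Lemma inball_bound f B x : inball f B -> Cmod (f x) <= B.
Proof.
  intros H; apply le_epsilon; intros d Hd.
  destruct (H d Hd) as [l [H1 H2]].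
  replace (f x) with (Cplus (Cminus (f x) (teval l x)) (teval l x)) by ring.
  eapply Rle_trans; [apply Cmod_triangle|].
  generalize (H2 x) (Cmod_teval l x); lra.
Qed.

Lemma inball_plus f g A B :
  inball f A -> inball g B -> inball (fun x => Cplus (f x) (g x)) (A + B).
Proof.
  intros Hf Hg d Hd.
  destruct (Hf (d / 2) ltac:(lra)) as [l [H1 H2]], (Hg (d / 2) ltac:(lra)) as [m [H3 H4]].
  exists (l ++ m); split; [rewrite tweight_app; lra|].
  intros x; rewrite teval_app.
  replace (Cminus (Cplus (f x) (g x)) (Cplus (teval l x) (teval m x)))
    with (Cplus (Cminus (f x) (teval l x)) (Cminus (g x) (teval m x))) by ring.
  eapply Rle_trans; [apply Cmod_triangle|]. generalize (H2 x) (H4 x); lra.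
Qed.

Lemma inball_conj f A : inball f A -> inball (fun x => Cconj (f x)) A.
Proof.
  intros Hf d Hd; destruct (Hf d Hd) as [l [H1 H2]].
  exists (tconj l); split; [rewrite tweight_tconj; exact H1|].
  intros x; rewrite teval_tconj, <- Cminus_conj, Cmod_conj; apply H2.
Qed.

Lemma inball_mult f g A B :
  inball f A -> inball g B -> inball (fun x => Cmult (f x) (g x)) (A * B).
Proof.
  intros Hf Hg d Hd.
  assert (HA := inball_ge_0 _ _ Hf); assert (HB := inball_ge_0 _ _ Hg).
  set (e := d / (A + B + 1)).
  assert (He : 0 < e) by (apply Rdiv_lt_0_compat; lra).
  assert (Ee : e * (A + B + 1) = d) by (unfold e; field; lra).
  destruct (Hf e He) as [l [H1 H2]], (Hg e He) as [m [H3 H4]].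
  exists (tmult l m); split.
  - rewrite tweight_tmult; apply Rmult_le_compat; auto using tweight_ge_0.
  - intros x; rewrite teval_tmult.
    replace (Cminus (Cmult (f x) (g x)) (Cmult (teval l x) (teval m x)))
      with (Cplus (Cmult (Cminus (f x) (teval l x)) (g x))
                  (Cmult (teval l x) (Cminus (g x) (teval m x)))) by ring.
    eapply Rle_trans; [apply Cmod_triangle|]; rewrite !Cmod_mult.
    assert (H5 := inball_bound _ _ x Hg).
    assert (H6 := Rle_trans _ _ _ (Cmod_teval l x) H1).
    specialize (H2 x); specialize (H4 x).
    assert (Cmod (f x - teval l x) * Cmod (g x) <= e * B)
      by (apply Rmult_le_compat; auto using Cmod_ge_0).
    assert (Cmod (teval l x) * Cmod (g x - teval m x) <= A * e)
      by (apply Rmult_le_compat; auto using Cmod_ge_0).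
    lra.
Qed.

(** Stated for arbitrary integer frequencies [ph j], so that it serves both for elements of
    W and for sums over the frequencies j N. *)
Lemma inball_CsumZ_tail (c : Z -> C) (ph : Z -> Z) n :
  ell1 c ->
  inball (fun x => Cminus (CsumZ (fun j => Cmult (c j) (expi (IZR (ph j) * x))))
            (lsum (zlist n) (fun j => Cmult (c j) (expi (IZR (ph j) * x)))))
    (tailZ (fun j => Cmod (c j)) n).
Proof.
  intros Hc d Hd.
  destruct (tailZ_small (fun j => Cmod (c j)) d ltac:(intros; apply Cmod_ge_0) Hc Hd) as [p Hp].
  exists (tlsum (ztail n p) c ph); split.
  - rewrite tweight_tlsum; apply (lsum_ztail_le (fun j => Cmod (c j)));
      [intros; apply Cmod_ge_0 | exact Hc].
  - intros x; rewrite teval_tlsum.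
    specialize (Hp (n + p)%nat ltac:(lia)).
    assert (E := ell1_twist c (fun j => IZR (ph j) * x) Hc).
    assert (T := Cmod_CsumZ_tail _ (n + p) E); cbv beta in T.
    replace (Cminus (Cminus (CsumZ (fun j => Cmult (c j) (expi (IZR (ph j) * x))))
            (lsum (zlist n) (fun j => Cmult (c j) (expi (IZR (ph j) * x)))))
            (lsum (ztail n p) (fun j => Cmult (c j) (expi (IZR (ph j) * x)))))
     with (Cminus (CsumZ (fun j => Cmult (c j) (expi (IZR (ph j) * x))))
            (lsum (zlist (n + p)) (fun j => Cmult (c j) (expi (IZR (ph j) * x))))).
    + eapply Rle_trans; [exact T|].
      assert (X := tailZ_le (fun k => Cmod (c k * expi (IZR (ph k) * x))) (fun k => Cmod (c k)) 1
        (n + p)).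
      rewrite Rmult_1_l in X; eapply Rle_trans; [apply X|exact Hp]; [|exact E|exact Hc].
      intros k; rewrite Cmod_mult, Cmod_expi; lra.
    + rewrite zlist_add, lsum_app; change (@plus C_AbelianMonoid) with Cplus; ring.
Qed.

Lemma inball_weval w : inball (weval w) (wnorm w).
Proof.
  assert (H := inball_CsumZ_tail (wcoef w) (fun j => j) 0 (wcoef_ell1 w)).
  replace (tailZ (fun j => Cmod (wcoef w j)) 0) with (wnorm w) in H.
  - apply (inball_ext _ (weval w)) in H; [exact H|].
    intros x; simpl; change (@zero C_AbelianMonoid) with (RtoC 0); unfold weval; ring.
  - unfold tailZ, wnorm; simpl; change (@zero R_AbelianMonoid) with 0; ring.
Qed.

(** The W-norm of a trigonometric polynomial is at most its weight. *)
Lemma lsum_tcoef_le (s : list Z) (l : trig) :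
  NoDup s -> lsum s (fun k => Cmod (tcoef l k)) <= tweight l.
Proof.
  intros Hs; induction l as [|[c j] l IH].
  - right; simpl. rewrite Cmod_0; apply (lsum_zero (G := R_AbelianMonoid)).
  - eapply Rle_trans;
      [apply (lsum_le _ _ (fun k => plus (if Z.eq_dec j k then Cmod c else 0) (Cmod (tcoef l k))))|].
    + intros k _; simpl; eapply Rle_trans; [apply Cmod_triangle|]. apply Rplus_le_compat_r.
      destruct (Z.eq_dec j k); [apply Rle_refl|rewrite Cmod_0; apply Rle_refl].
    + rewrite (lsum_plus (G := R_AbelianMonoid)); simpl.
      apply Rplus_le_compat; [|exact IH].
      destruct (in_dec Z.eq_dec j s) as [Hj|Hj].
      * right; apply (lsum_delta (G := R_AbelianMonoid) s j (fun _ => Cmod c) Hs Hj).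
      * rewrite (lsum_ext _ _ (fun _ => zero)), (lsum_zero (G := R_AbelianMonoid));
          [apply Cmod_ge_0|].
        intros k Hk; destruct (Z.eq_dec j k) as [<-|]; [contradiction|reflexivity].
Qed.

(** The converse of [inball_weval]: the closed balls of W are closed for uniform
    convergence within W. Each coefficient of [w] is within [d] of that of an approximating
    polynomial, which bounds every finite partial sum of the norm by [B] plus a
    multiple of [d]. *)
Lemma inball_wnorm w B : inball (weval w) B -> wnorm w <= B.
Proof.
  intros H; apply sumZ_le_bound; [apply wcoef_ell1|]; intros m.
  apply le_epsilon; intros e He.
  set (L := INR (length (zlist m)) + 1).
  assert (HL : 1 <= L) by (unfold L; generalize (pos_INR (length (zlist m))); lra).
  set (d := e / L).
  assert (Hd : 0 < d) by (apply Rdiv_lt_0_compat; lra).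
  assert (Ed : d * L = e) by (unfold d; field; lra).
  destruct (H d Hd) as [l [H1 H2]].
  (* A truncation of [w] has the same coefficient at k and is uniformly close to [w]. *)
  assert (K : forall k, Cmod (Cminus (wcoef w k) (tcoef l k)) <= d).
  { intros k; apply le_epsilon; intros h Hh.
    destruct (tailZ_small (fun j => Cmod (wcoef w j)) h ltac:(intros; apply Cmod_ge_0)
      (wcoef_ell1 w) Hh) as [p Hp].
    set (q := (p + Z.to_nat (Z.abs k + 1))%nat).
    specialize (Hp q ltac:(unfold q; lia)).
    assert (T := inball_CsumZ_tail (wcoef w) (fun j => j) q (wcoef_ell1 w)).
    set (t := tlsum (zlist q) (wcoef w) (fun j => j)).
    replace (Cminus (wcoef w k) (tcoef l k)) with
      (tcoef (t ++ tscal (RtoC (-1)) 0 l) k).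
    - apply tcoef_le; intros x.
      rewrite teval_app, teval_tscal, Rmult_0_l, expi_0.
      assert (T' := inball_bound _ _ x T); cbv beta in T'.
      rewrite <- teval_tlsum in T'; fold t in T'.
      change (CsumZ (fun j : Z => (wcoef w j * expi (IZR j * x))%C)) with (weval w x) in T'.
      specialize (H2 x).
      replace (teval t x + -1 * 1 * teval l x)%C with
        (Cminus (Cminus (weval w x) (teval l x)) (Cminus (weval w x) (teval t x))).
      + eapply Rle_trans; [apply Cmod_triangle|]. rewrite Cmod_opp; lra.
      + apply injective_projections; simpl; ring.
    - rewrite tcoef_app, tcoef_tscal, Z.sub_0_r; unfold t.
      rewrite tcoef_tlsum_id; [apply injective_projections; simpl; ring|apply zlist_NoDup|].
      apply zlist_In; unfold q; lia. }
  eapply Rle_trans; [apply (lsum_le _ _ (fun k => plus (Cmod (tcoef l k)) d))|].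
  - intros k _; specialize (K k).
    replace (wcoef w k) with (Cplus (tcoef l k) (Cminus (wcoef w k) (tcoef l k))) by ring.
    eapply Rle_trans; [apply Cmod_triangle|]. apply Rplus_le_compat_l, K.
  - rewrite (lsum_plus (G := R_AbelianMonoid) _ (fun k => Cmod (tcoef l k))), lsum_const.
    apply Rplus_le_compat.
    + eapply Rle_trans; [apply lsum_tcoef_le, zlist_NoDup|exact H1].
    + unfold L in *; lra.
Qed.

(** * Linear maps and integrals with values in W *)

Lemma is_linear_Cscal (c : C) (w : Wiener) :
  is_linear (U := CR)
    (V := Wiener_NormedModule) (fun z : C => wCscal (Cmult c z) w).
Proof.
  constructor.
  - intros x y; apply Wiener_eq; intros k; simpl.
    apply injective_projections; simpl; unfold plus; simpl; ring.
  - intros r z; apply Wiener_eq; intros k; simpl.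
    apply injective_projections; simpl; unfold scal; simpl; unfold mult; simpl; ring.
  - exists (Cmod c * wnorm w + 1); split.
    + generalize (Rmult_le_pos _ _ (Cmod_ge_0 c) (wnorm_ge_0 w)); lra.
    + intros z; rewrite norm_C_R.
      change (wnorm (wCscal (Cmult c z) w) <= (Cmod c * wnorm w + 1) * Cmod z).
      rewrite wnorm_Cscal, Cmod_mult; generalize (Cmod_ge_0 z); nra.
Qed.

Lemma is_RInt_lsum (l : list Z) (f : Z -> R -> Wiener) (I : Z -> Wiener) a b :
  (forall k, is_RInt (f k) a b (I k)) ->
  is_RInt (fun s => lsum l (fun k => f k s) : Wiener) a b (lsum l I).
Proof.
  intros H; induction l as [|k l IH]; simpl.
  - assert (H0 := is_RInt_const (V := Wiener_NormedModule) a b zero).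
    rewrite (scal_zero_r (V := Wiener_ModuleSpace)) in H0; exact H0.
  - apply (is_RInt_plus (V := Wiener_NormedModule) (f k)); [apply H|exact IH].
Qed.

Lemma continuous_expi (w t : R) :
  continuous (U := prod_UniformSpace R_UniformSpace R_UniformSpace) (fun s => expi (w * s)) t.
Proof.
  assert (L : continuous (fun s => w * s) t).
  { apply (continuous_mult (fun _ => w) (fun s => s)); [apply continuous_const|apply continuous_id]. }
  assert (Hc := continuous_comp (fun s => w * s) cos t L (continuous_cos _)).
  assert (Hs := continuous_comp (fun s => w * s) sin t L (continuous_sin _)).
  apply filterlim_locally; intros e.
  apply (proj1 (filterlim_locally _ _)) with (eps := e) in Hc.
  apply (proj1 (filterlim_locally _ _)) with (eps := e) in Hs.
  generalize (filter_and _ _ Hc Hs); apply filter_imp; intros s [H1 H2]; split; assumption.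
Qed.

Lemma continuous_lsum (l : list Z) (f : Z -> R -> Wiener) t :
  (forall k, continuous (f k) t) ->
  continuous (fun s => lsum l (fun k => f k s) : Wiener) t.
Proof.
  intros H; induction l as [|k l IH]; simpl.
  - apply (continuous_const (U := R_UniformSpace) (V := Wiener_UniformSpace)).
  - apply (continuous_plus (V := Wiener_NormedModule) (f k)); [apply H|exact IH].
Qed.

Lemma wCscal_lsum c l (f : Z -> Wiener) : wCscal c (lsum l f) = lsum l (fun k => wCscal c (f k)).
Proof.
  apply (lsum_morph (G := Wiener_AbelianMonoid) (H := Wiener_AbelianMonoid) (wCscal c)).
  - wiener_eq.
  - intros x y; wiener_eq.
Qed.

Lemma lsum_wCscal l (f : Z -> C) w : lsum l (fun k => wCscal (f k) w) = wCscal (lsum l f) w.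
Proof.
  symmetry; apply (lsum_morph (G := C_AbelianMonoid) (H := Wiener_AbelianMonoid)
    (fun c => wCscal c w)).
  - wiener_eq.
  - intros x y; wiener_eq.
Qed.

Lemma free_flow_lsum eps t l (f : Z -> Wiener) :
  free_flow eps t (lsum l f) = lsum l (fun k => free_flow eps t (f k)).
Proof.
  apply (lsum_morph (G := Wiener_AbelianMonoid) (H := Wiener_AbelianMonoid) (free_flow eps t)).
  - wiener_eq.
  - intros x y; wiener_eq.
Qed.

Lemma free_flow_minus eps t v w :
  free_flow eps t (minus v w) = minus (free_flow eps t v) (free_flow eps t w).
Proof. wiener_eq. Qed.

Lemma wnorm_free_flow eps t w : wnorm (free_flow eps t w) = wnorm w.
Proof.
  unfold wnorm, sumZ; f_equal; apply Series_ext; intros n; simpl;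
    rewrite Cmod_mult, Cmod_expi, Rmult_1_l; reflexivity.
Qed.

Lemma free_flow_wmono eps t c k :
  free_flow eps t (wCscal c (wmono k))
  = wCscal (Cmult c (expi (- (eps * IZR k ^ 2 * t / 2)))) (wmono k).
Proof.
  apply Wiener_eq; intros j; simpl; unfold delta.
  destruct (Z.eq_dec k j) as [->|]; [simpl; ring|ring].
Qed.

(** * The truncated approximate solution *)

Section Profile.

Context (lambda eps : R) (N : Z) (alpha : Z -> C) (n : nat).
Context (heps : 0 < eps) (hN : IZR N = / eps) (halpha : ell1 alpha).

(** [Sn] is the set of retained modes, [A] the l^1 norm of alpha and [M] its mass. *)
Let Sn := zlist n.
Let A := sumZ (fun k => Cmod (alpha k)).
Let M := sumZ (fun k => Cmod (alpha k) ^ 2).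

(** The nonlinear phase shift of mode j. It uses the full mass M, not that of the
    retained modes. *)
Definition theta (j : Z) : R := lambda * (2 * M - Cmod (alpha j) ^ 2).
(** The total time frequency of mode j: the linear part is eps (j N)^2 / 2 = j^2 / (2 eps). *)
Definition freq (j : Z) : R := theta j + IZR j ^ 2 / (2 * eps).
(** The Fourier coefficient of the approximate solution at frequency j N. *)
Definition amp (j : Z) (t : R) : C := Cmult (alpha j) (expi (- freq j * t)).
(** The approximate solution restricted to the modes of [Sn], as an element of W. *)
Definition profile (t : R) : Wiener := lsum Sn (fun j => wCscal (amp j t) (wmono (j * N))).

(** The contribution of three modes to |g|^2 g, where g is the profile. *)
Definition cubic_term (a b c : Z) (t : R) : Wiener :=
  wCscal (Cmult (Cmult (amp a t) (Cconj (amp b t))) (amp c t)) (wmono ((a - b + c) * N)).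
(** The element of W denoting |g|^2 g. *)
Definition cubic (t : R) : Wiener :=
  lsum Sn (fun a => lsum Sn (fun b => lsum Sn (fun c => cubic_term a b c t))).

(** The time frequency left in the Duhamel integrand of the modes a, b, c. *)
Definition Omega (a b c : Z) : R :=
  - (theta a - theta b + theta c) + IZR ((b - a) * (b - c)) / eps.

(** The Duhamel integral of [cubic_term a b c], see [is_RInt_cubic_term]. *)
Definition Vint (t : R) (a b c : Z) : Wiener :=
  wCscal (Cmult (Cmult (Cmult (Cmult (alpha a) (Cconj (alpha b))) (alpha c))
                   (expi (- (IZR (a - b + c) ^ 2 / (2 * eps)) * t)))
            (Eint (Omega a b c) t))
    (wmono ((a - b + c) * N)).

Lemma weval_profile t x :
  weval (profile t) x = lsum Sn (fun j => Cmult (amp j t) (expi (IZR (j * N) * x))).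
Proof.
  unfold profile; rewrite weval_lsum; apply lsum_ext; intros k _.
  rewrite weval_wCscal, weval_wmono; reflexivity.
Qed.

Lemma weval_cubic t x :
  weval (cubic t) x = Cmult (RtoC (Cmod (weval (profile t) x) ^ 2)) (weval (profile t) x).
Proof.
  rewrite Cmod2_conj.
  rewrite weval_profile, Cconj_lsum.
  unfold cubic; rewrite weval_lsum.
  rewrite Cmult_lsum_r, Cmult_lsum_r.
  apply lsum_ext; intros a _.
  rewrite weval_lsum, (Cmult_lsum_l (Cmult (amp a t) (expi (IZR (a * N) * x))) Sn
    (fun k => Cconj (Cmult (amp k t) (expi (IZR (k * N) * x))))), Cmult_lsum_r.
  apply lsum_ext; intros b _.
  rewrite weval_lsum, Cmult_lsum_l.
  apply lsum_ext; intros c _.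
  unfold cubic_term; rewrite weval_wCscal, weval_wmono.
  rewrite Cmult_conj, <- expi_opp.
  replace (IZR ((a - b + c) * N) * x) with
    (IZR (a * N) * x + (- (IZR (b * N) * x) + IZR (c * N) * x))
    by (rewrite !mult_IZR, plus_IZR, minus_IZR; ring).
  rewrite !expi_plus; match goal with |- ?a = ?b => change (@eq C a b) end; ring.
Qed.

Lemma is_RInt_cubic_term t a b c :
  is_RInt (fun s => free_flow eps (t - s) (cubic_term a b c s)) 0 t (Vint t a b c).
Proof.
  apply (is_RInt_ext (fun s => wCscal (Cmult (Cmult (Cmult (Cmult (alpha a) (Cconj (alpha b)))
     (alpha c)) (expi (- (IZR (a - b + c) ^ 2 / (2 * eps)) * t))) (expi (Omega a b c * s)))
     (wmono ((a - b + c) * N)))).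
  - intros s _; unfold cubic_term; rewrite free_flow_wmono; f_equal.
    unfold amp; rewrite Cmult_conj, <- expi_opp.
    transitivity (Cmult (Cmult (Cmult (alpha a) (Cconj (alpha b))) (alpha c))
      (expi (- (IZR (a - b + c) ^ 2 / (2 * eps)) * t + Omega a b c * s)));
      [rewrite expi_plus; ring|].
    replace (- (IZR (a - b + c) ^ 2 / (2 * eps)) * t + Omega a b c * s) with
      (- freq a * s + (- (- freq b * s) + (- freq c * s
         + - (eps * IZR ((a - b + c) * N) ^ 2 * (t - s) / 2)))).
    + rewrite !expi_plus; ring.
    + unfold freq, Omega; rewrite !mult_IZR, !plus_IZR, !minus_IZR, hN; field; lra.
  - apply (is_RInt_linear (U := CR)
      (V := Wiener_NormedModule) (fun z => wCscal (Cmult (Cmult (Cmult (Cmult (alpha a)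
      (Cconj (alpha b))) (alpha c)) (expi (- (IZR (a - b + c) ^ 2 / (2 * eps)) * t))) z)
     (wmono ((a - b + c) * N))) (fun s => expi (Omega a b c * s))).
    + apply is_linear_Cscal.
    + apply is_RInt_expi.
Qed.

(** The Duhamel integral of [cubic]. *)
Definition Vsum (t : R) : Wiener :=
  lsum Sn (fun a => lsum Sn (fun b => lsum Sn (fun c => Vint t a b c))).

Lemma is_RInt_cubic t :
  is_RInt (fun s => free_flow eps (t - s) (cubic s)) 0 t (Vsum t).
Proof.
  apply (is_RInt_ext (fun s => lsum Sn (fun a => lsum Sn (fun b => lsum Sn (fun c =>
    free_flow eps (t - s) (cubic_term a b c s)))) : Wiener)).
  - intros s _; unfold cubic; rewrite free_flow_lsum; apply lsum_ext; intros a _.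
    rewrite free_flow_lsum; apply lsum_ext; intros b _.
    rewrite free_flow_lsum; reflexivity.
  - apply (is_RInt_lsum Sn (fun a s => lsum Sn (fun b => lsum Sn (fun c =>
       free_flow eps (t - s) (cubic_term a b c s))))
       (fun a => lsum Sn (fun b => lsum Sn (fun c => Vint t a b c)))); intros a.
    apply (is_RInt_lsum Sn (fun b s => lsum Sn (fun c =>
       free_flow eps (t - s) (cubic_term a b c s)))
       (fun b => lsum Sn (fun c => Vint t a b c))); intros b.
    apply (is_RInt_lsum Sn (fun c s => free_flow eps (t - s) (cubic_term a b c s))); intros c.
    apply is_RInt_cubic_term.
Qed.

Lemma continuous_profile t : continuous profile t.
Proof.
  apply (continuous_lsum Sn (fun j s => wCscal (amp j s) (wmono (j * N)))); intros j.
  apply (continuous_comp (V := prod_UniformSpace R_UniformSpace R_UniformSpace)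
    (fun s => expi (- freq j * s)) (fun z => wCscal (Cmult (alpha j) z) (wmono (j * N)))).
  - apply continuous_expi.
  - apply (linear_cont (U := CR)
      (V := Wiener_NormedModule)), is_linear_Cscal.
Qed.

Lemma Cmod_amp j t : Cmod (amp j t) = Cmod (alpha j).
Proof. unfold amp; rewrite Cmod_mult, Cmod_expi; ring. Qed.

Lemma lsum_alpha_le : lsum Sn (fun j => Cmod (alpha j)) <= A.
Proof. apply (lsum_le_sumZ (fun j => Cmod (alpha j))); [intros; apply Cmod_ge_0|exact halpha]. Qed.

Lemma wnorm_profile t : wnorm (profile t) <= A.
Proof.
  eapply Rle_trans; [apply wnorm_lsum|].
  eapply Rle_trans; [|apply lsum_alpha_le].
  apply lsum_le; intros j _; rewrite wnorm_Cscal, Cmod_amp.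
  generalize (wnorm_wmono (j * N)) (wnorm_ge_0 (wmono (j * N))) (Cmod_ge_0 (alpha j)); nra.
Qed.

(** ** Resonant interactions *)

(** The Duhamel integral of the mode c of the profile, common factor of all resonant
    contributions at frequency c N. *)
Definition rterm (t : R) (c : Z) : Wiener :=
  wCscal (Cmult (Cmult (alpha c) (expi (- (IZR c ^ 2 / (2 * eps)) * t))) (Eint (- theta c) t))
    (wmono (c * N)).

Definition sq (j : Z) : C := RtoC (Cmod (alpha j) ^ 2).

(** The resonant part of [Vint]. The triples a = b and the triples b = c are counted
    separately, and the third term corrects for a = b = c. *)
Definition res (t : R) (a b c : Z) : Wiener :=
  wplus (if Z.eq_dec a b then wCscal (sq b) (rterm t c) else zero)
    (wplus (if Z.eq_dec b c then wCscal (sq c) (rterm t a) else zero)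
       (if Z.eq_dec a b then
          (if Z.eq_dec b c then wCscal (Copp (sq c)) (rterm t c) else zero) else zero)).

Definition nonres (t : R) (a b c : Z) : Wiener :=
  if Z.eq_dec a b then zero else if Z.eq_dec b c then zero else Vint t a b c.

Lemma Omega_res_l a c : Omega a a c = - theta c.
Proof. unfold Omega; rewrite Z.sub_diag, Z.mul_0_l; field; lra. Qed.
Lemma Omega_res_r a c : Omega a c c = - theta a.
Proof. unfold Omega; rewrite Z.sub_diag, Z.mul_0_r; field; lra. Qed.

Lemma sq_conj j : sq j = Cmult (alpha j) (Cconj (alpha j)).
Proof. unfold sq; apply Cmod2_conj. Qed.

Lemma Vint_split t a b c : Vint t a b c = wplus (res t a b c) (nonres t a b c).
Proof.
  unfold res, nonres; destruct (Z.eq_dec a b) as [->|Hab].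
  - transitivity (wCscal (sq b) (rterm t c)).
    + unfold Vint, rterm; rewrite Omega_res_l, sq_conj.
      replace (b - b + c)%Z with c by ring.
      apply Wiener_eq; intros k; simpl; ring.
    + destruct (Z.eq_dec b c) as [->|_]; apply Wiener_eq; intros k; simpl; ring.
  - destruct (Z.eq_dec b c) as [->|Hbc].
    + transitivity (wCscal (sq c) (rterm t a)).
      * unfold Vint, rterm; rewrite Omega_res_r, sq_conj.
        replace (a - c + c)%Z with a by ring.
        apply Wiener_eq; intros k; simpl; ring.
      * apply Wiener_eq; intros k; simpl; ring.
    + apply Wiener_eq; intros k; simpl; ring.
Qed.

(** The mass of the retained modes. *)
Let Mn := lsum Sn (fun k => Cmod (alpha k) ^ 2).

Lemma lsum_sq : lsum Sn sq = RtoC Mn.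
Proof.
  symmetry; apply (lsum_morph (G := R_AbelianMonoid) (H := C_AbelianMonoid) RtoC); [reflexivity|].
  intros x y; apply RtoC_plus.
Qed.

(** Each family of resonant triples contributes the mass of the retained modes, and the
    diagonal is subtracted once. *)
Lemma lsum_res t :
  lsum Sn (fun a => lsum Sn (fun b => lsum Sn (fun c => res t a b c)))
  = lsum Sn (fun c => wCscal (RtoC (2 * Mn - Cmod (alpha c) ^ 2)) (rterm t c)).
Proof.
  assert (ND : NoDup Sn) by apply zlist_NoDup.
  transitivity (wplus
    (lsum Sn (fun a => lsum Sn (fun b => lsum Sn (fun c =>
      if Z.eq_dec a b then wCscal (sq b) (rterm t c) else zero))))
   (wplus (lsum Sn (fun a => lsum Sn (fun b => lsum Sn (fun c =>
      if Z.eq_dec b c then wCscal (sq c) (rterm t a) else zero))))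
    (lsum Sn (fun a => lsum Sn (fun b => lsum Sn (fun c =>
       if Z.eq_dec a b then
          (if Z.eq_dec b c then wCscal (Copp (sq c)) (rterm t c) else zero) else zero)))))).
  { change wplus with (@plus Wiener_AbelianMonoid).
    rewrite <- !lsum_plus; apply lsum_ext; intros a _.
    rewrite <- !lsum_plus; apply lsum_ext; intros b _.
    rewrite <- !lsum_plus; reflexivity. }
  transitivity (wplus (lsum Sn (fun c => wCscal (RtoC Mn) (rterm t c)))
    (wplus (lsum Sn (fun c => wCscal (RtoC Mn) (rterm t c)))
       (lsum Sn (fun c => wCscal (Copp (sq c)) (rterm t c))))).
  - f_equal; [|f_equal].
    + transitivity (lsum Sn (fun a => lsum Sn (fun c => wCscal (sq a) (rterm t c)))).
      * apply lsum_ext; intros a Ha; rewrite lsum_swap; apply lsum_ext; intros c _.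
        apply (lsum_delta Sn a (fun b => wCscal (sq b) (rterm t c)) ND Ha).
      * rewrite lsum_swap; apply lsum_ext; intros c _.
        rewrite lsum_wCscal, lsum_sq; reflexivity.
    + apply lsum_ext; intros a _.
      transitivity (lsum Sn (fun b => wCscal (sq b) (rterm t a))).
      * apply lsum_ext; intros b Hb.
        apply (lsum_delta Sn b (fun c => wCscal (sq c) (rterm t a)) ND Hb).
      * rewrite lsum_wCscal, lsum_sq; reflexivity.
    + apply lsum_ext; intros a Ha.
      rewrite <- (lsum_delta Sn a (fun c => wCscal (Copp (sq c)) (rterm t c)) ND Ha).
      apply lsum_ext; intros b Hb.
      destruct (Z.eq_dec a b); [|apply lsum_zero].
      apply (lsum_delta Sn b (fun c => wCscal (Copp (sq c)) (rterm t c)) ND Hb).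
  - change wplus with (@plus Wiener_AbelianMonoid).
    rewrite <- !lsum_plus; apply lsum_ext; intros c _.
    apply Wiener_eq; intros k; simpl; unfold sq; apply injective_projections; simpl; ring.
Qed.

Lemma Vsum_split t :
  Vsum t = wplus (lsum Sn (fun c => wCscal (RtoC (2 * Mn - Cmod (alpha c) ^ 2)) (rterm t c)))
    (lsum Sn (fun a => lsum Sn (fun b => lsum Sn (fun c => nonres t a b c)))).
Proof.
  rewrite <- lsum_res; unfold Vsum; change wplus with (@plus Wiener_AbelianMonoid).
  rewrite <- !lsum_plus; apply lsum_ext; intros a _.
  rewrite <- !lsum_plus; apply lsum_ext; intros b _.
  rewrite <- !lsum_plus; apply lsum_ext; intros c _.
  apply Vint_split.
Qed.

(** The linear evolution of the profile is corrected exactly by the resonant integral with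
    factor theta. *)
Lemma profile_evol t :
  minus (profile t) (free_flow eps t (profile 0))
  = lsum Sn (fun c => wCscal (Cmult (Copp Ci) (RtoC (theta c))) (rterm t c)).
Proof.
  unfold profile; rewrite free_flow_lsum.
  transitivity (lsum Sn (fun j => minus (wCscal (amp j t) (wmono (j * N)))
    (free_flow eps t (wCscal (amp j 0) (wmono (j * N)))))).
  { transitivity (wplus (lsum Sn (fun j => wCscal (amp j t) (wmono (j * N))))
      (wCscal (RtoC (-1)) (lsum Sn (fun j =>
         free_flow eps t (wCscal (amp j 0) (wmono (j * N))))))); [reflexivity|].
    rewrite wCscal_lsum; change wplus with (@plus Wiener_AbelianMonoid).
    rewrite <- lsum_plus; reflexivity. }
  apply lsum_ext; intros j _; rewrite free_flow_wmono; unfold rterm.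
  assert (E := Eint_eq (- theta j) t).
  assert (E1 : amp j t = Cmult (Cmult (alpha j) (expi (- (IZR j ^ 2 / (2 * eps)) * t)))
     (expi (- theta j * t))).
  { unfold amp; rewrite <- Cmult_assoc, <- expi_plus; do 2 f_equal; unfold freq; ring. }
  assert (E2 : expi (- (eps * IZR (j * N) ^ 2 * t / 2)) = expi (- (IZR j ^ 2 / (2 * eps)) * t)).
  { f_equal; rewrite mult_IZR, hN; field; lra. }
  assert (E3 : amp j 0 = alpha j).
  { unfold amp; rewrite Rmult_0_r, expi_0; ring. }
  rewrite E1, E2, E3.
  assert (E4 : Cmult (Cmult (Copp Ci) (RtoC (theta j))) (Eint (- theta j) t)
     = Cminus (expi (- theta j * t)) (RtoC 1)).
  { rewrite <- E, RtoC_opp; ring. }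
  revert E4.
  generalize (expi (- (IZR j ^ 2 / (2 * eps)) * t)) (expi (- theta j * t)) (Eint (- theta j) t).
  intros e1 e2 e3 E4; apply Wiener_eq; intros k; simpl.
  transitivity (Cmult (Cmult (Cmult (alpha j) e1)
    (Cmult (Cmult (Copp Ci) (RtoC (theta j))) e3)) (delta (j * N) k)); [|ring].
  rewrite E4; apply injective_projections; simpl; ring.
Qed.

Lemma ex_sumZ_sq : ex_sumZ (fun k => Cmod (alpha k) ^ 2).
Proof.
  apply (ex_sumZ_le _ (fun k => A * Cmod (alpha k))); [|apply ex_sumZ_scal, halpha].
  intros k; split; [apply pow_le, Cmod_ge_0|].
  assert (Cmod (alpha k) <= A)
    by (apply (sumZ_ge_term (fun k => Cmod (alpha k))); [intros; apply Cmod_ge_0|exact halpha]).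
  generalize (Cmod_ge_0 (alpha k)); nra.
Qed.

Lemma Cmod_alpha_le k : Cmod (alpha k) <= A.
Proof. apply (sumZ_ge_term (fun k => Cmod (alpha k))); [intros; apply Cmod_ge_0|exact halpha]. Qed.

Lemma mass_le : M <= A ^ 2.
Proof.
  replace (A ^ 2) with (sumZ (fun k => A * Cmod (alpha k))) by (rewrite sumZ_scal; unfold A; ring).
  apply sumZ_le; [|apply ex_sumZ_scal, halpha].
  intros k; split; [apply pow_le, Cmod_ge_0|].
  generalize (Cmod_alpha_le k) (Cmod_ge_0 (alpha k)); nra.
Qed.

Lemma mass_tail : 0 <= M - Mn <= A * tailZ (fun k => Cmod (alpha k)) n.
Proof.
  split.
  - apply (tailZ_ge_0 (fun k => Cmod (alpha k) ^ 2)); [intros; apply pow_le, Cmod_ge_0|].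
    apply ex_sumZ_sq.
  - apply (tailZ_le (fun k => Cmod (alpha k) ^ 2)); [|apply ex_sumZ_sq|exact halpha].
    intros k; generalize (Cmod_alpha_le k) (Cmod_ge_0 (alpha k)); nra.
Qed.

Lemma theta_le j : Rabs (theta j) <= 2 * Rabs lambda * A ^ 2.
Proof.
  unfold theta; rewrite Rabs_mult.
  assert (H1 : Cmod (alpha j) ^ 2 <= M)
    by (apply (sumZ_ge_term (fun k => Cmod (alpha k) ^ 2));
        [intros; apply pow_le, Cmod_ge_0|apply ex_sumZ_sq]).
  assert (H2 : 0 <= Cmod (alpha j) ^ 2) by apply pow_le, Cmod_ge_0.
  rewrite (Rabs_pos_eq (2 * M - _)) by lra.
  generalize mass_le (Rabs_pos lambda); nra.
Qed.

(** The product (b - a) (b - c) is a nonzero integer, and the three phases theta are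
    bounded, so the frequency is at least 1/eps - 6 |lambda| A^2 >= 1/(2 eps). *)
Lemma Eint_nonres t a b c :
  12 * Rabs lambda * A ^ 2 * eps <= 1 -> a <> b -> b <> c ->
  Cmod (Eint (Omega a b c) t) <= 4 * eps.
Proof.
  intros He Hab Hbc.
  assert (H0 := Eint_osc (Omega a b c) t).
  assert (H1 : / (2 * eps) <= Rabs (Omega a b c)).
  { assert (K : / eps <= Rabs (IZR ((b - a) * (b - c)) / eps)).
    { unfold Rdiv; rewrite Rabs_mult, (Rabs_pos_eq (/ eps))
        by (left; apply Rinv_0_lt_compat, heps).
      rewrite <- (Rmult_1_l (/ eps)) at 1.
      apply Rmult_le_compat_r; [left; apply Rinv_0_lt_compat, heps|].
      rewrite <- abs_IZR; apply IZR_le.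
      assert (((b - a) * (b - c))%Z <> 0%Z) by (intros E; apply Z.mul_eq_0 in E; lia); lia. }
    assert (Q : 6 * Rabs lambda * A ^ 2 <= / (2 * eps)).
    { apply (Rmult_le_reg_l (2 * eps)); [lra|]. rewrite Rinv_r by lra; lra. }
    assert (Q2 : / eps = 2 * / (2 * eps)) by (field; lra).
    set (p := theta a - theta b + theta c).
    assert (P : Rabs p <= 6 * Rabs lambda * A ^ 2).
    { unfold p, Rminus.
      generalize (theta_le a) (theta_le b) (theta_le c)
        (Rabs_triang (theta a + - theta b) (theta c)) (Rabs_triang (theta a) (- theta b)).
      rewrite Rabs_Ropp; lra. }
    unfold Omega; fold p.
    generalize (Rabs_triang (- p + IZR ((b - a) * (b - c)) / eps) p).
    replace (- p + IZR ((b - a) * (b - c)) / eps + p) with (IZR ((b - a) * (b - c)) / eps) by ring.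
    lra. }
  assert (H2 : / (2 * eps) * Cmod (Eint (Omega a b c) t) <= 2).
  { eapply Rle_trans; [|exact H0]. apply Rmult_le_compat_r; [apply Cmod_ge_0|exact H1]. }
  apply (Rmult_le_reg_l (/ (2 * eps))); [apply Rinv_0_lt_compat; lra|].
  replace (/ (2 * eps) * (4 * eps)) with 2 by (field; lra); exact H2.
Qed.

Lemma wnorm_nonres t :
  12 * Rabs lambda * A ^ 2 * eps <= 1 ->
  wnorm (lsum Sn (fun a => lsum Sn (fun b => lsum Sn (fun c => nonres t a b c)))) <= 4 * eps * A ^ 3.
Proof.
  intros He.
  set (An := lsum Sn (fun j => Cmod (alpha j)) : R).
  assert (HA : An <= A) by apply lsum_alpha_le.
  assert (HA0 : 0 <= An) by (apply lsum_nonneg; intros; apply Cmod_ge_0).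
  apply Rle_trans with (4 * eps * An ^ 3).
  2: { apply Rmult_le_compat_l; [lra|]. apply pow_incr; split; assumption. }
  replace (4 * eps * An ^ 3) with (4 * eps * An ^ 2 * An) by ring.
  unfold An at 2; rewrite <- lsum_scal_l.
  eapply Rle_trans; [apply wnorm_lsum|]; apply lsum_le; intros a _.
  replace (4 * eps * An ^ 2 * Cmod (alpha a)) with (4 * eps * An * Cmod (alpha a) * An) by ring.
  unfold An at 2; rewrite <- lsum_scal_l.
  eapply Rle_trans; [apply wnorm_lsum|]; apply lsum_le; intros b _.
  replace (4 * eps * An * Cmod (alpha a) * Cmod (alpha b))
    with (4 * eps * Cmod (alpha a) * Cmod (alpha b) * An) by ring.
  unfold An; rewrite <- lsum_scal_l.
  eapply Rle_trans; [apply wnorm_lsum|]; apply lsum_le; intros c _.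
  assert (Z0 : 0 <= 4 * eps * Cmod (alpha a) * Cmod (alpha b) * Cmod (alpha c)).
  { repeat apply Rmult_le_pos; try apply Cmod_ge_0; lra. }
  assert (W0 : wnorm zero <= 4 * eps * Cmod (alpha a) * Cmod (alpha b) * Cmod (alpha c)).
  { eapply Rle_trans; [|exact Z0]. right; apply (norm_zero (V := Wiener_NormedModule)). }
  unfold nonres; destruct (Z.eq_dec a b) as [|Hab]; [exact W0|].
  destruct (Z.eq_dec b c) as [|Hbc]; [exact W0|].
  unfold Vint; rewrite wnorm_Cscal, !Cmod_mult, Cmod_conj, Cmod_expi, Rmult_1_r.
  assert (HE := Eint_nonres t a b c He Hab Hbc).
  assert (H1 := wnorm_wmono ((a - b + c) * N)).
  assert (H2 := wnorm_ge_0 (wmono ((a - b + c) * N))).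
  assert (H3 : 0 <= Cmod (alpha a) * Cmod (alpha b) * Cmod (alpha c)).
  { repeat apply Rmult_le_pos; apply Cmod_ge_0. }
  assert (H4 := Cmod_ge_0 (Eint (Omega a b c) t)).
  apply Rle_trans with (Cmod (alpha a) * Cmod (alpha b) * Cmod (alpha c) * (4 * eps) * 1);
    [|right; ring].
  apply Rmult_le_compat; [apply Rmult_le_pos; assumption|exact H2| |exact H1].
  apply Rmult_le_compat_l; assumption.
Qed.

Lemma wnorm_rterm t c : 0 <= t -> wnorm (rterm t c) <= t * Cmod (alpha c).
Proof.
  intros Ht; unfold rterm; rewrite wnorm_Cscal, !Cmod_mult, Cmod_expi, Rmult_1_r.
  apply Rle_trans with (Cmod (alpha c) * t * 1); [|right; ring].
  apply Rmult_le_compat; [apply Rmult_le_pos; apply Cmod_ge_0|apply wnorm_ge_0| |apply wnorm_wmono].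
  apply Rmult_le_compat_l; [apply Cmod_ge_0|apply Eint_le, Ht].
Qed.

(** The profile solves the equation in Duhamel form up to a small error: the first term
    comes from M minus the mass of the retained modes, the second one from the nonresonant
    triples. *)
Lemma profile_defect t :
  0 <= t -> 12 * Rabs lambda * A ^ 2 * eps <= 1 ->
  wnorm (minus (profile t)
    (minus (free_flow eps t (profile 0)) (wCscal (Cmult Ci (RtoC lambda)) (Vsum t))))
  <= Rabs lambda * (2 * (A * tailZ (fun k => Cmod (alpha k)) n) * (t * A) + 4 * eps * A ^ 3).
Proof.
  intros Ht He.
  set (nr := lsum Sn (fun a => lsum Sn (fun b => lsum Sn (fun c => nonres t a b c))) : Wiener).
  assert (E : minus (profile t)
    (minus (free_flow eps t (profile 0)) (wCscal (Cmult Ci (RtoC lambda)) (Vsum t)))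
    = wCscal (Cmult Ci (RtoC lambda))
       (wplus (lsum Sn (fun c => wCscal (RtoC (2 * (Mn - M))) (rterm t c))) nr)).
  { transitivity (wplus (minus (profile t) (free_flow eps t (profile 0)))
      (wCscal (Cmult Ci (RtoC lambda)) (Vsum t))); [wiener_eq|].
    rewrite profile_evol, Vsum_split; fold nr.
    transitivity (wplus (wplus
       (lsum Sn (fun c => wCscal (Cmult (Copp Ci) (RtoC (theta c))) (rterm t c)))
       (wCscal (Cmult Ci (RtoC lambda))
          (lsum Sn (fun c => wCscal (RtoC (2 * Mn - Cmod (alpha c) ^ 2)) (rterm t c)))))
       (wCscal (Cmult Ci (RtoC lambda)) nr)); [wiener_eq|].
    transitivity (wplus (wCscal (Cmult Ci (RtoC lambda))
       (lsum Sn (fun c => wCscal (RtoC (2 * (Mn - M))) (rterm t c))))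
       (wCscal (Cmult Ci (RtoC lambda)) nr)); [|wiener_eq].
    f_equal; rewrite !wCscal_lsum; change wplus with (@plus Wiener_AbelianMonoid).
    rewrite <- lsum_plus; apply lsum_ext; intros c _.
    apply Wiener_eq; intros k; simpl; unfold theta; apply injective_projections; simpl; ring. }
  rewrite E, wnorm_Cscal, Cmod_mult, Cmod_Ci, Cmod_R, Rmult_1_l.
  apply Rmult_le_compat_l; [apply Rabs_pos|].
  eapply Rle_trans; [apply wnorm_triangle|]; apply Rplus_le_compat; [|apply wnorm_nonres, He].
  destruct mass_tail as [H1 H2].
  apply Rle_trans with (2 * (M - Mn) * t * lsum Sn (fun c => Cmod (alpha c))).
  - rewrite <- lsum_scal_l.
    eapply Rle_trans; [apply wnorm_lsum|]; apply lsum_le; intros c _.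
    rewrite wnorm_Cscal, Cmod_R.
    replace (2 * (Mn - M)) with (- (2 * (M - Mn))) by ring.
    rewrite Rabs_Ropp, Rabs_pos_eq by lra.
    rewrite (Rmult_assoc (2 * (M - Mn))).
    apply Rmult_le_compat_l; [lra|apply wnorm_rterm, Ht].
  - generalize lsum_alpha_le; intros H3.
    assert (H4 : 0 <= lsum Sn (fun c => Cmod (alpha c)))
      by (apply lsum_nonneg; intros; apply Cmod_ge_0).
    rewrite Rmult_assoc.
    apply Rmult_le_compat; [lra|apply Rmult_le_pos; assumption|lra|].
    apply Rmult_le_compat_l; assumption.
Qed.

End Profile.

(** * Gronwall and continuity arguments *)

(** The hypothesis is the integral inequality y(t) <= a + b int_0^t y, used only through the
    majorants L exp(2 b s) of [y], so that [y] need not be integrable. It turns the majorant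
    with constant L into the one with constant a + L/2; starting from
    L = 2 a + 1, which the a priori bound allows, iteration leads to the fixed point 2 a. *)
Lemma gronwall_weighted (y : R -> R) (a b tau : R) :
  0 <= a -> 0 < b -> (forall s, 0 <= s <= tau -> y s <= 1) ->
  (forall L, 0 <= L -> (forall s, 0 <= s <= tau -> y s <= L * exp (2 * b * s)) ->
    forall t, 0 <= t <= tau -> y t <= a + L * (exp (2 * b * t) - 1) / 2) ->
  forall t, 0 <= t <= tau -> y t <= 2 * a * exp (2 * b * t).
Proof.
  intros Ha Hb H1 HL.
  assert (HE : forall s, 0 <= s -> 1 <= exp (2 * b * s)).
  { intros s Hs; rewrite <- exp_0; destruct (Req_dec s 0) as [->|].
    - rewrite Rmult_0_r; lra.
    - left; apply exp_increasing; nra. }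
  assert (K : forall n, forall s, 0 <= s <= tau ->
    y s <= (2 * a + (/ 2) ^ n) * exp (2 * b * s)).
  { induction n as [|n IH]; intros s Hs.
    - specialize (H1 s Hs); specialize (HE s (proj1 Hs)); rewrite pow_O.
      revert HE; generalize (exp (2 * b * s)); intros; nra.
    - assert (P : 0 < (/ 2) ^ n) by (apply pow_lt; lra).
      specialize (HL (2 * a + (/ 2) ^ n) ltac:(lra) IH s Hs); specialize (HE s (proj1 Hs)).
      change ((/ 2) ^ S n) with (/ 2 * (/ 2) ^ n).
      revert HL HE P; generalize (exp (2 * b * s)) ((/ 2) ^ n); intros; nra. }
  intros t Ht; apply le_epsilon; intros e He.
  assert (Hx : 0 < exp (2 * b * t)) by apply exp_pos.
  destruct (pow_lt_1_zero (/ 2) ltac:(rewrite Rabs_pos_eq; lra) (e / exp (2 * b * t))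
    (Rdiv_lt_0_compat _ _ He Hx)) as [n Hn].
  specialize (Hn n (le_n n)).
  rewrite Rabs_pos_eq in Hn by (left; apply pow_lt; lra).
  apply (Rmult_lt_compat_r _ _ _ Hx) in Hn.
  replace (e / exp (2 * b * t) * exp (2 * b * t)) with e in Hn by (field; lra).
  specialize (K n t Ht); lra.
Qed.

(** A continuous [y] that cannot exceed 1/2 before having exceeded 1 never exceeds 1. *)
Lemma bootstrap (y : R -> R) (T : R) :
  0 <= T ->
  (forall t, 0 <= t <= T ->
     filterlim y (within (fun t => 0 <= t <= T) (locally t)) (locally (y t))) ->
  y 0 <= 1 ->
  (forall tau, 0 <= tau <= T -> (forall s, 0 <= s <= tau -> y s <= 1) -> y tau <= / 2) ->
  forall s, 0 <= s <= T -> y s <= 1.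
Proof.
  intros HT Hc H0 Hb.
  assert (Hc' : forall t, 0 <= t <= T -> forall e, 0 < e -> exists d, 0 < d /\
    forall s, 0 <= s <= T -> Rabs (s - t) < d -> Rabs (y s - y t) < e).
  { intros t Ht e He.
    destruct (proj1 (filterlim_locally _ _) (Hc t Ht) (mkposreal e He)) as [d Hd].
    exists d; split; [apply cond_pos|]; intros s Hs Hst; apply (Hd s); [exact Hst|exact Hs]. }
  set (E := fun tau => 0 <= tau <= T /\ forall s, 0 <= s <= tau -> y s <= 1).
  assert (E0 : E 0).
  { split; [lra|]; intros s Hs; replace s with 0 by lra; exact H0. }
  destruct (completeness E) as [m [Hm1 Hm2]].
  { exists T; intros tau [Ht _]; lra. }
  { exists 0; exact E0. }
  assert (Hm : 0 <= m <= T).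
  { split; [apply Hm1, E0|apply Hm2; intros tau [Ht _]; lra]. }
  assert (Hlt : forall s, 0 <= s < m -> y s <= 1).
  { intros s Hs; apply Rnot_lt_le; intros Hys.
    assert (m <= s); [|lra].
    apply Hm2; intros tau [Ht1 Ht2]; apply Rnot_lt_le; intros Hst.
    specialize (Ht2 s ltac:(lra)); lra. }
  assert (Hym : y m <= 1).
  { destruct (Req_dec m 0) as [->|Hm0]; [exact H0|].
    apply Rnot_lt_le; intros Hy.
    destruct (Hc' m Hm (y m - 1) ltac:(lra)) as [d [Hd1 Hd2]].
    set (s := m - Rmin (d / 2) (m / 2)).
    assert (Hs : m - d < s < m /\ 0 <= s).
    { unfold s, Rmin; destruct (Rle_dec (d / 2) (m / 2)); lra. }
    specialize (Hd2 s ltac:(lra) ltac:(apply Rabs_def1; lra)).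
    apply Rabs_def2 in Hd2; specialize (Hlt s ltac:(lra)); lra. }
  assert (Em : forall s, 0 <= s <= m -> y s <= 1).
  { intros s Hs; destruct (Req_dec s m) as [->|]; [exact Hym|apply Hlt; lra]. }
  destruct (Req_dec m T) as [<-|HmT]; [exact Em|].
  exfalso.
  assert (Hh := Hb m Hm Em).
  destruct (Hc' m Hm (/ 2) ltac:(lra)) as [d [Hd1 Hd2]].
  set (q := Rmin (m + d / 2) T).
  assert (Hq : m < q <= T /\ q < m + d).
  { unfold q, Rmin; destruct (Rle_dec (m + d / 2) T); lra. }
  assert (q <= m); [|lra].
  apply Hm1; split; [lra|]; intros s Hs.
  destruct (Rle_dec s m) as [Hsm|Hsm]; [apply Em; lra|].
  specialize (Hd2 s ltac:(lra) ltac:(apply Rabs_def1; lra)).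
  apply Rabs_def2 in Hd2; lra.
Qed.

Lemma is_RInt_exp (L b t : R) : 0 < b ->
  is_RInt (fun s => L * exp (2 * b * s)) 0 t (L * (exp (2 * b * t) - 1) / (2 * b)).
Proof.
  intros Hb.
  replace (L * (exp (2 * b * t) - 1) / (2 * b)) with
    (minus (L * exp (2 * b * t) / (2 * b)) (L * exp (2 * b * 0) / (2 * b))).
  - apply (is_RInt_derive (fun s => L * exp (2 * b * s) / (2 * b))).
    + intros s _; auto_derive; [trivial|field; lra].
    + intros s _; apply (ex_derive_continuous (fun s => L * exp (2 * b * s))).
      auto_derive; trivial.
  - unfold minus, plus, opp; simpl; rewrite Rmult_0_r, exp_0; field; lra.
Qed.

(** * The cubic nonlinearity is locally Lipschitz on W *)

(** The difference is the sum of (p - q) p* p, q (p - q)* p and q q* (p - q), where * is the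
    conjugation. *)
Lemma cubic_lipschitz (p q F G : Wiener) (K : R) :
  wnorm p <= K -> wnorm q <= K ->
  (forall x, weval F x = Cmult (RtoC (Cmod (weval p x) ^ 2)) (weval p x)) ->
  (forall x, weval G x = Cmult (RtoC (Cmod (weval q x) ^ 2)) (weval q x)) ->
  wnorm (minus F G) <= 3 * K ^ 2 * wnorm (minus p q).
Proof.
  intros Hp Hq HF HG; apply inball_wnorm.
  assert (Bp := inball_le _ _ _ Hp (inball_weval p)).
  assert (Bq := inball_le _ _ _ Hq (inball_weval q)).
  assert (Bd := inball_weval (minus p q)).
  replace (3 * K ^ 2 * wnorm (minus p q)) with
    (wnorm (minus p q) * K * K + (K * wnorm (minus p q) * K + K * K * wnorm (minus p q))) by ring.
  apply (inball_ext (fun x =>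
    Cplus (Cmult (Cmult (weval (minus p q) x) (Cconj (weval p x))) (weval p x))
     (Cplus (Cmult (Cmult (weval q x) (Cconj (weval (minus p q) x))) (weval p x))
            (Cmult (Cmult (weval q x) (Cconj (weval q x))) (weval (minus p q) x))))).
  - intros x; rewrite !weval_minus, HF, HG, !Cmod2_conj, Cminus_conj; ring.
  - apply (inball_plus (fun x => Cmult (Cmult (weval (minus p q) x) (Cconj (weval p x))) (weval p x))).
    + apply (inball_mult (fun x => Cmult (weval (minus p q) x) (Cconj (weval p x)))); [|exact Bp].
      apply inball_mult; [exact Bd|apply inball_conj, Bp].
    + apply (inball_plus (fun x => Cmult (Cmult (weval q x) (Cconj (weval (minus p q) x))) (weval p x))).
      * apply (inball_mult (fun x => Cmult (weval q x) (Cconj (weval (minus p q) x)))); [|exact Bp].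
        apply inball_mult; [exact Bq|apply inball_conj, Bd].
      * apply (inball_mult (fun x => Cmult (weval q x) (Cconj (weval q x)))); [|exact Bd].
        apply inball_mult; [exact Bq|apply inball_conj, Bq].
Qed.

(** * Stability *)

(** An approximate Duhamel solution [g], with nonlinear term [G] and Duhamel integral [J],
    stays close to the exact one: [D] bounds the error on the initial data plus the defect
    of [g] in the Duhamel formula. The bound assumed on [g] leaves room for a difference
    of norm 1, and the smallness of [D] closes the continuity argument. *)
Lemma duhamel_stability (lambda eps T K D : R) (w0 : Wiener) (u g G J : R -> Wiener) :
  lambda <> 0 -> 0 < T -> 1 <= K -> 0 <= D ->
  2 * D * exp (6 * Rabs lambda * K ^ 2 * T) <= / 2 ->
  NLS_solution lambda eps T w0 u ->
  (forall t, continuous g t) ->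
  (forall t, wnorm (g t) <= K - 1) ->
  (forall t x, weval (G t) x = Cmult (RtoC (Cmod (weval (g t) x) ^ 2)) (weval (g t) x)) ->
  (forall t, is_RInt (fun s => free_flow eps (t - s) (G s)) 0 t (J t)) ->
  (forall t, 0 <= t <= T ->
     wnorm (minus w0 (g 0)) +
     wnorm (minus (g t) (minus (free_flow eps t (g 0)) (wCscal (Cmult Ci (RtoC lambda)) (J t))))
     <= D) ->
  forall t, 0 <= t <= T ->
    wnorm (minus (u t) (g t)) <= 2 * D * exp (6 * Rabs lambda * K ^ 2 * T).
Proof.
  intros Hl HT HK HD Hsmall [Hu [F [HF HI]]] Hg HgK HG HJ Hdef.
  set (y := fun t => wnorm (minus (u t) (g t))).
  set (b := 3 * Rabs lambda * K ^ 2).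
  assert (Hla : 0 < Rabs lambda) by (apply Rabs_pos_lt, Hl).
  assert (HK2 : 0 < K ^ 2) by (apply pow_lt; lra).
  assert (Hb : 0 < b) by (unfold b; nra).
  (* The basic estimate, for any integrable majorant [h] of the nonlinear difference. *)
  assert (Hmain : forall t h L, 0 <= t <= T -> is_RInt h 0 t L ->
    (forall s, 0 <= s <= t -> wnorm (minus (F s) (G s)) <= h s) -> y t <= D + Rabs lambda * L).
  { intros t h L Ht Hh Hs.
    destruct (HI t Ht) as [I [HI1 HI2]].
    assert (HL : wnorm (minus I (J t)) <= L).
    { apply (norm_RInt_le (V := Wiener_NormedModule)
        (fun s => minus (free_flow eps (t - s) (F s)) (free_flow eps (t - s) (G s))) h 0 t).
      - apply Ht.
      - intros s Hst; rewrite <- free_flow_minus.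
        change (wnorm (free_flow eps (t - s) (minus (F s) (G s))) <= h s).
        rewrite wnorm_free_flow; apply Hs, Hst.
      - apply (is_RInt_minus (V := Wiener_NormedModule)); [exact HI1|apply HJ].
      - exact Hh. }
    set (e := minus (g t)
      (minus (free_flow eps t (g 0)) (wCscal (Cmult Ci (RtoC lambda)) (J t)))).
    assert (E : minus (u t) (g t) = wplus (free_flow eps t (minus w0 (g 0)))
      (wplus (wCscal (Cmult (RtoC (-1)) (Cmult Ci (RtoC lambda))) (minus I (J t)))
         (wCscal (RtoC (-1)) e))) by (rewrite HI2; unfold e; wiener_eq).
    unfold y; rewrite E.
    eapply Rle_trans; [apply wnorm_triangle|].
    generalize (wnorm_triangle (wCscal (Cmult (RtoC (-1)) (Cmult Ci (RtoC lambda)))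
      (minus I (J t))) (wCscal (RtoC (-1)) e)).
    rewrite wnorm_free_flow, !wnorm_Cscal, !Cmod_mult, Cmod_Ci, !Cmod_R.
    replace (Rabs (-1)) with 1 by (rewrite Rabs_left by lra; ring).
    specialize (Hdef t Ht); fold e in Hdef.
    generalize (Rmult_le_compat_l _ _ _ (Rlt_le _ _ Hla) HL); lra. }
  assert (Hexp : forall t, t <= T -> exp (2 * b * t) <= exp (6 * Rabs lambda * K ^ 2 * T)).
  { intros t Ht; replace (6 * Rabs lambda * K ^ 2 * T) with (2 * b * T) by (unfold b; ring).
    destruct (Req_dec t T) as [->|]; [apply Rle_refl|left; apply exp_increasing; nra]. }
  assert (Hgr : forall tau, 0 <= tau <= T -> (forall s, 0 <= s <= tau -> y s <= 1) ->
    y tau <= 2 * D * exp (6 * Rabs lambda * K ^ 2 * T)).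
  { intros tau Htau H1.
    apply Rle_trans with (2 * D * exp (2 * b * tau)).
    2: { apply Rmult_le_compat_l; [lra|apply Hexp; lra]. }
    apply (gronwall_weighted y D b tau HD Hb H1); [|lra].
    intros L HL0 HL t Ht.
    replace (D + L * (exp (2 * b * t) - 1) / 2) with
      (D + Rabs lambda * ((3 * K ^ 2 * L) * (exp (2 * b * t) - 1) / (2 * b)))
      by (unfold b; field; lra).
    apply (Hmain t (fun s => (3 * K ^ 2 * L) * exp (2 * b * s))); [lra| |].
    - apply is_RInt_exp, Hb.
    - intros s Hs.
      apply Rle_trans with (3 * K ^ 2 * y s).
      + apply cubic_lipschitz.
        * replace (u s) with (wplus (minus (u s) (g s)) (g s)) by wiener_eq.
          generalize (wnorm_triangle (minus (u s) (g s)) (g s)) (HgK s) (H1 s ltac:(lra)).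
          unfold y; lra.
        * generalize (HgK s); lra.
        * apply HF; lra.
        * apply HG.
      + specialize (HL s ltac:(lra)).
        replace (3 * K ^ 2 * L * exp (2 * b * s)) with (3 * K ^ 2 * (L * exp (2 * b * s))) by ring.
        apply Rmult_le_compat_l; [lra|exact HL]. }
  assert (H1 : forall s, 0 <= s <= T -> y s <= 1).
  { apply bootstrap.
    - lra.
    - intros t Ht; unfold y.
      apply (filterlim_comp _ _ _ (fun t => minus (u t) (g t)) wnorm _
        (locally (minus (u t) (g t) : Wiener))).
      + apply (filterlim_comp_2 (G := locally (u t : Wiener)) (H := locally (opp (g t) : Wiener))
          (F := within (fun t => 0 <= t <= T) (locally t)) u (fun t => opp (g t)) plus).
        * apply (Hu t Ht).
        * apply (filterlim_filter_le_1 (F := locally t)); [apply filter_le_within|].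
          apply (continuous_opp (V := Wiener_NormedModule)), Hg.
        * apply (filterlim_plus (V := Wiener_NormedModule)).
      + apply (filterlim_norm (V := Wiener_NormedModule)).
    (* At time 0 the integral vanishes, so [y 0] is at most [D]. *)
    - apply Rle_trans with (D + Rabs lambda * (wnorm (minus (F 0) (G 0)) * 0)).
      + apply (Hmain 0 (fun _ => wnorm (minus (F 0) (G 0)))); [lra|apply is_RInt_cst|].
        intros s Hs; replace s with 0 by lra; apply Rle_refl.
      + assert (X := Hexp 0 ltac:(lra)); rewrite Rmult_0_r, exp_0 in X; nra.
    - intros tau Htau Hs; eapply Rle_trans; [apply Hgr; assumption|exact Hsmall]. }
  intros t Ht; apply (Hgr t Ht); intros s Hs; apply H1; lra.
Qed.

(** * Validity of the multiphase approximation *)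

Theorem theorem1p1 (lambda : R) (hlambda : lambda <> 0)
  (alpha : Z -> C) (halpha : ell1 alpha)
  (u0 : R -> Wiener) (C0 : R) (hC0 : 0 <= C0)
  (hu0 : forall eps : R, 0 < eps -> recip_posint eps ->
     exists v : Wiener,
       (forall x : R,
          weval v x = CsumZ (fun j => Cmult (alpha j) (expi (IZR j * x / eps)))) /\
       norm (minus (u0 eps) v) <= C0 * eps)
  (u : R -> R -> Wiener) :
  forall T : R, 0 < T ->
  exists Cst eps0 : R, 0 < eps0 /\
  forall eps : R, 0 < eps <= eps0 -> recip_posint eps ->
  NLS_solution lambda eps T (u0 eps) (u eps) ->
  forall t : R, 0 <= t <= T ->
    Rbar_le (Linf_norm (fun x => Cminus (weval (u eps t) x) (u_app lambda alpha eps t x)))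
            (Cst * eps).
Proof.
  intros T HT.
  set (A := sumZ (fun k => Cmod (alpha k))).
  assert (HA : 0 <= A).
  { eapply Rle_trans; [apply (Cmod_ge_0 (alpha 0%Z))|].
    apply (Cmod_alpha_le alpha halpha). }
  set (la := Rabs lambda).
  assert (Hla : 0 < la) by (apply Rabs_pos_lt, hlambda).
  set (D := C0 + 1 + la * (2 * A * (T * A) + 4 * A ^ 3)).
  assert (HD : 0 < D).
  { assert (0 <= A ^ 3) by (apply pow_le, HA).
    assert (0 <= A * (T * A)) by (repeat apply Rmult_le_pos; lra).
    unfold D; nra. }
  set (X := exp (6 * la * (A + 1) ^ 2 * T)).
  assert (HX : 0 < X) by apply exp_pos.
  (* eps <= / Q makes both 2 (D eps) X <= 1/2, for the stability estimate, and
     12 la A^2 eps <= 1, for the nonresonant integrals. *)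
  set (Q := 4 * D * X + 12 * la * A ^ 2).
  assert (HA2 : 0 <= A ^ 2) by (apply pow_le, HA).
  assert (HDX : 0 < D * X) by (apply Rmult_lt_0_compat; assumption).
  assert (HQ : 0 < Q) by (unfold Q; nra).
  exists (2 * D * X + 1), (/ Q); split; [apply Rinv_0_lt_compat, HQ|].
  intros eps [He1 He2] Hrec Hsol t Ht.
  assert (HeQ : Q * eps <= 1).
  { apply (Rmult_le_compat_l Q) in He2; [|lra]. rewrite Rinv_r in He2 by lra; exact He2. }
  destruct (hu0 eps He1 Hrec) as [v [Hv1 Hv2]].
  destruct Hrec as [Nn [_ HN]].
  set (N := Z.of_nat Nn).
  assert (hN : IZR N = / eps).
  { unfold N; rewrite <- INR_IZR_INZ, <- HN; unfold Rdiv; ring. }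
  destruct (tailZ_small (fun k => Cmod (alpha k)) eps ltac:(intros; apply Cmod_ge_0) halpha He1)
    as [n Hn].
  specialize (Hn n (le_n n)).
  set (g := profile lambda eps N alpha n).
  assert (Hamp : forall s, ell1 (fun j => amp lambda eps alpha j s)).
  { intros s; apply ell1_twist, halpha. }
  assert (Htail : forall s, tailZ (fun j => Cmod (amp lambda eps alpha j s)) n <= eps).
  { intros s; eapply Rle_trans; [apply (tailZ_le _ (fun k => Cmod (alpha k)) 1)|];
      [|apply Hamp|exact halpha|lra].
    intros k; rewrite Cmod_amp; lra. }
  (* At each time the full approximate solution differs from the profile by a tail. *)
  assert (Happ : forall s, inball (fun x => Cminus (CsumZ (fun j =>
     Cmult (amp lambda eps alpha j s) (expi (IZR (j * N) * x)))) (weval (g s) x)) eps).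
  { intros s; eapply inball_le; [apply (Htail s)|].
    eapply inball_ext; [|apply (inball_CsumZ_tail _ (fun j => (j * N)%Z) n (Hamp s))].
    intros x; unfold g; rewrite weval_profile; reflexivity. }
  assert (Hinit : wnorm (minus (u0 eps) (g 0)) <= (C0 + 1) * eps).
  { assert (H1 : wnorm (minus v (g 0)) <= eps).
    { apply inball_wnorm; eapply inball_ext; [|apply (Happ 0)].
      intros x; rewrite weval_minus, Hv1; f_equal; apply CsumZ_ext; intros j.
      unfold amp; rewrite Rmult_0_r, expi_0, Cmult_1_r; do 2 f_equal.
      rewrite mult_IZR, hN; field; lra. }
    replace (minus (u0 eps) (g 0)) with (wplus (minus (u0 eps) v) (minus v (g 0))) by wiener_eq.
    eapply Rle_trans; [apply wnorm_triangle|].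
    change (wnorm (minus (u0 eps) v) <= C0 * eps) in Hv2; lra. }
  assert (Hw : wnorm (minus (u eps t) (g t)) <= 2 * (D * eps) * X).
  { unfold X, la; apply (duhamel_stability lambda eps T (A + 1) (D * eps) (u0 eps) (u eps) g
      (cubic lambda eps N alpha n) (Vsum lambda eps N alpha n)); try assumption; try lra.
    - apply Rmult_le_pos; lra.
    - fold la; fold X. unfold Q in HeQ.
      assert (0 <= 12 * la * A ^ 2 * eps) by (repeat apply Rmult_le_pos; lra). lra.
    - intros s; apply continuous_profile.
    - intros s; replace (A + 1 - 1) with A by ring; apply wnorm_profile, halpha.
    - intros s x; apply weval_cubic.
    - intros s; apply is_RInt_cubic; assumption.
    - intros s Hs.
      assert (H2 := profile_defect lambda eps N alpha n He1 hN halpha s (proj1 Hs)).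
      fold A la g in H2.
      assert (HS : 12 * la * A ^ 2 * eps <= 1).
      { unfold Q in HeQ; generalize (Rmult_lt_0_compat _ _ HDX He1); lra. }
      specialize (H2 HS).
      apply Rle_trans with ((C0 + 1) * eps + la * (2 * (A * eps) * (T * A) + 4 * eps * A ^ 3)).
      + apply Rplus_le_compat; [exact Hinit|].
        eapply Rle_trans; [exact H2|].
        apply Rmult_le_compat_l; [lra|]; apply Rplus_le_compat_r.
        assert (Ht0 : 0 <= tailZ (fun k => Cmod (alpha k)) n)
          by (apply tailZ_ge_0; [intros; apply Cmod_ge_0|exact halpha]).
        apply Rmult_le_compat.
        * repeat apply Rmult_le_pos; lra.
        * apply Rmult_le_pos; lra.
        * apply Rmult_le_compat_l; [lra|]; apply Rmult_le_compat_l; lra.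
        * apply Rmult_le_compat_r; lra.
      + right; unfold D; ring. }
  assert (Hx : forall x, Cmod (Cminus (weval (u eps t) x) (u_app lambda alpha eps t x))
    <= (2 * D * X + 1) * eps).
  { intros x.
    assert (Eu : u_app lambda alpha eps t x = CsumZ (fun j =>
      Cmult (amp lambda eps alpha j t) (expi (IZR (j * N) * x)))).
    { unfold u_app; apply CsumZ_ext; intros j; unfold amp.
      rewrite <- !Cmult_assoc, <- !expi_plus; do 2 f_equal.
      unfold freq, theta; rewrite mult_IZR, hN; field; lra. }
    assert (H1 := inball_bound _ _ x (Happ t)); cbv beta in H1; rewrite <- Eu in H1.
    assert (H2 := inball_bound _ _ x (inball_weval (minus (u eps t) (g t)))).
    rewrite weval_minus in H2.
    replace (Cminus (weval (u eps t) x) (u_app lambda alpha eps t x)) with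
      (Cminus (Cminus (weval (u eps t) x) (weval (g t) x))
        (Cminus (u_app lambda alpha eps t x) (weval (g t) x))) by ring.
    eapply Rle_trans; [apply Cmod_triangle|]; rewrite Cmod_opp; lra. }
  unfold Linf_norm; apply (proj2 (Lub_Rbar_correct _)).
  intros r [x ->]; apply Hx.
Qed.
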